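(* Let $0<l<\infty$ and let $\Phi_1(x)$ be an $m_2\times m_1$ matrix function which is boundedly differentiable on the interval $[0,l]$ and satisfies the inequality $$I_{m_2}-\Phi_1(0)\Phi_1(0)^*>0.$$ For $0<r\le l$ let the operator $S_r\in B\big(L^2_{m_2}(0,r)\big)$ be given by $$(S_rf)(x)=\big(I_{m_2}-\Phi_1(0)\Phi_1(0)^*\big)f(x)-\int_0^r s(x,t)f(t)\,dt,$$ $$s(x,t)=\int_0^{\min(x,t)}\Phi_1'(x-\zeta)\Phi_1'(t-\zeta)^*\,d\zeta+\begin{cases}\Phi_1'(x-t)\Phi_1(0)^*, & x>t,\\ \Phi_1(0)\Phi_1'(t-x)^*, & t>x,\end{cases}$$ and suppose that $S_r$ is boundedly invertible for all $0<r\le l$. Then the operators $S_r$ $(0<r\le l)$ are strictly positive (i.e., $S_r>0$).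
   Context: $m_1,m_2$ are positive integers; $I_{m_2}$ is the $m_2\times m_2$ identity matrix; matrices and scalars are complex. $L^2_{m_2}(0,r)$ is the Hilbert space of square-integrable $\mathbb{C}^{m_2}$-valued functions on $(0,r)$, and $B(\mathbf H)$ denotes the bounded linear operators on $\mathbf H$. ''Boundedly differentiable'' means differentiable with bounded derivative. ''Boundedly invertible'' means having an inverse in $B\big(L^2_{m_2}(0,r)\big)$. For a matrix, $>0$ means positive definite; for an operator, ''strictly positive'' ($S_r>0$) means $S_r\ge\delta I$ for some $\delta>0$ (which may depend on $r$), where $I$ is the identity operator. The star denotes conjugate transpose of a matrix. *)

(* Defs.v *)
From HB Require Import structures.
From mathcomp Require Import all_boot all_order all_algebra.
From mathcomp Require Import spectral complex.
From mathcomp Require Import all_classical all_reals all_analysis.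
Import Order.TTheory GRing.Theory Num.Theory numFieldNormedType.Exports.

Set Implicit Arguments.
Unset Strict Implicit.
Unset Printing Implicit Defensive.

Local Open Scope classical_set_scope.
Local Open Scope ring_scope.
Local Open Scope complex_scope.
Local Open Scope sesquilinear_scope.

Section Calculus.
Context {R : realType}.

(* The topology on [R[i]] (hence on matrices over it) is only inferred once
   [R[i]] is seen as the carrier of a [numFieldType]. *)
Definition diff_quotient m n (F : R -> 'M[R[i]]_(m, n)) (x y : R) :
  'M[R[i] : numFieldType]_(m, n) := ((y - x)^-1)%:C *: (F y - F x).

(* Derivative at [x] relative to [A]: one-sided at the endpoints when [A] is a
   closed interval. *)
Definition derivable_within m n (A : set R) (F : R -> 'M[R[i]]_(m, n))
  (x : R) : Prop := cvg (diff_quotient F x @ within A x^').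

Definition derive_within m n (A : set R) (F : R -> 'M[R[i]]_(m, n))
  (x : R) : 'M[R[i]]_(m, n) := lim (diff_quotient F x @ within A x^').

Definition boundedly_differentiable m n (A : set R)
    (F : R -> 'M[R[i]]_(m, n)) : Prop :=
  (forall x, A x -> derivable_within A F x) /\
  (exists K : R, forall x, A x ->
     forall i j, `|derive_within A F x i j| <= K%:C).

(* The library integrates only extended-real functions, so real and imaginary
   parts, and matrix entries, are integrated separately. *)
Definition Cintegral (D : set R) (f : R -> R[i]) : R[i] :=
  (\int[lebesgue_measure]_(x in D) complex.Re (f x))%R +i*
  (\int[lebesgue_measure]_(x in D) complex.Im (f x))%R.

Definition mxintegral m n (D : set R) (F : R -> 'M[R[i]]_(m, n)) :
  'M[R[i]]_(m, n) := \matrix_(i, j) Cintegral D (fun x => F x i j).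

(* Over the complex numbers this forces [A] to be Hermitian: [0 < z] in [R[i]]
   means that [z] is real and positive. *)
Definition posdefmx n (A : 'M[R[i]]_n) : Prop :=
  forall v : 'cV[R[i]]_n, v != 0 -> 0 < (v^t* *m A *m v) 0 0.

End Calculus.

(* The Hilbert space of square-integrable functions on ]0, r[ is handled
   through representatives: its elements are the functions satisfying
   [inL2 r], identified when they are [eqL2 r]. *)
Section L2.
Context {R : realType} {m : nat}.
Implicit Types (r : R) (f g : R -> 'cV[R[i]]_m)
  (T : (R -> 'cV[R[i]]_m) -> (R -> 'cV[R[i]]_m)).

Definition sqnormv (v : 'cV[R[i]]_m) : R :=
  \sum_(i < m) Normc.normc (v i 0) ^+ 2.

Definition inL2 r f : Prop :=
  (forall i, measurable_fun `]0, r[ (fun x => complex.Re (f x i 0)) /\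
             measurable_fun `]0, r[ (fun x => complex.Im (f x i 0))) /\
  (\int[lebesgue_measure]_(x in `]0%R, r[) (sqnormv (f x))%:E < +oo)%E.

Definition eqL2 r f g : Prop := f = g %[ae lebesgue_measure in `]0, r[%classic].

Definition L2dot r f g : R[i] :=
  Cintegral `]0, r[ (fun x => ((g x)^t* *m f x) 0 0).

Definition L2norm r f : R :=
  Num.sqrt (\int[lebesgue_measure]_(x in `]0, r[) sqnormv (f x))%R.

(* [T] represents an element of B(L^2(0, r)).  Linearity (up to [eqL2]) and
   boundedness together imply that [T] is compatible with [eqL2]. *)
Definition bounded_operator r T : Prop :=
  [/\ forall f, inL2 r f -> inL2 r (T f),
      forall (a : R[i]) f g, inL2 r f -> inL2 r g ->
        eqL2 r (T (fun x => a *: f x + g x)) (fun x => a *: T f x + T g x) &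
      exists K : R, forall f, inL2 r f -> L2norm r (T f) <= K * L2norm r f].

Definition boundedly_invertible r T : Prop :=
  exists U, bounded_operator r U /\
    forall f, inL2 r f -> eqL2 r (U (T f)) f /\ eqL2 r (T (U f)) f.

(* [T - delta I] is nonnegative; here [0 <= z] in [R[i]] means that [z] is real
   and nonnegative. *)
Definition strictly_positive r T : Prop :=
  exists2 delta : R, 0 < delta &
    forall f, inL2 r f -> 0 <= L2dot r (fun x => T f x - delta%:C *: f x) f.

End L2.

Section OperatorS.
Context {R : realType} {m1 m2 : nat}.
Variables (l : R) (Phi1 : R -> 'M[R[i]]_(m2, m1)).

Let dPhi1 : R -> 'M[R[i]]_(m2, m1) := derive_within `[0, l] Phi1.

(* The value on the diagonal [x = t], a null set, is irrelevant. *)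
Definition kernel_s (x t : R) : 'M[R[i]]_m2 :=
  mxintegral `]0, Num.min x t[
    (fun zeta => dPhi1 (x - zeta) *m (dPhi1 (t - zeta))^t*)
  + (if t < x then dPhi1 (x - t) *m (Phi1 0)^t*
     else if x < t then Phi1 0 *m (dPhi1 (t - x))^t*
     else 0).

Definition operator_S (r : R) (f : R -> 'cV[R[i]]_m2) (x : R) :
    'cV[R[i]]_m2 :=
  (1%:M - Phi1 0 *m (Phi1 0)^t*) *m f x
  - mxintegral `]0, r[ (fun t => kernel_s x t *m f t).

End OperatorS.

(* Main.v *)
Require Import Defs.
From HB Require Import structures.
From mathcomp Require Import all_boot all_order all_algebra.
From mathcomp Require Import spectral complex.
From mathcomp Require Import all_classical all_reals all_analysis.
From mathcomp Require Import measurable_realfun ring lra.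
Import Order.TTheory GRing.Theory Num.Theory numFieldNormedType.Exports.

Set Implicit Arguments.
Unset Strict Implicit.
Unset Printing Implicit Defensive.

Local Open Scope classical_set_scope.
Local Open Scope ring_scope.
Local Open Scope complex_scope.
Local Open Scope sesquilinear_scope.

(* The operators S_r are the compressions to L^2(0, r) of one Hermitian form,
   coercive up to a bounded kernel, on functions on (0, l). If the form is
   nonnegative on L^2(0, r), evaluating it at f - (S_r f) / M shows that
   |S_r f|^2 <= M <S_r f, f>, so bounded invertibility upgrades nonnegativity
   to strict positivity. A function on (0, s), s > r, splits into its parts on
   (0, r) and [r, s); the cross term comes from the kernel alone and is small
   with s - r, while the form is positive on the second part. Hence the set of
   lengths r for which the form is nonnegative contains its supremum, which by
   strict positivity cannot be less than l. Everything is done with real and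
   imaginary parts, as a real symmetric form on families of functions indexed
   by 'I_m2 * bool. *)

(** * Square-integrable functions *)

(** Strict positivity on (0, r) comes with a constant that depends on r and may degenerate as r
    grows, so it does not simply pass to a limit. The continuation rests on a weight [e] in Young's
    inequality. Let F1, F2 be the parts of a function on (0, r) and [r, s), and c the kernel bound
    times the number of real components. The cross term is at most c e l |F1|^2 + c (s - r) |F2|^2 /
    e; once [e] is fixed, the coercivity of the matrix absorbs the second summand for small s - r.
    At the supremum [e] may depend on the function, so plain nonnegativity below it suffices; beyond
    the supremum [e] is tied to the strict positivity constant reached there. The factor s - r is
    available because the kernel is bounded: its form is controlled by L^1 norms, which
    Cauchy-Schwarz turns into the measure of the support. Bounded invertibility enters as the lower
    bound |f| <= K |S_r f|. The real form sees only real parts, so the reality of <S_r f, f> is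
    recovered from symmetry and commutation with multiplication by i. *)

Section SquareIntegrable.
Context d (T : measurableType d) (R : realType).
Variable mu : {sigma_finite_measure set T -> \bar R}.
Implicit Types (u v w : T -> R) (A : set T).

Definition itg u := mu.-integrable setT (EFin \o u).

Lemma dominated_itg u v : measurable_fun setT u -> itg v ->
  (forall x, `|u x| <= v x) -> itg u.
Proof.
move=> mu_ iv uv; apply: (le_integrable _ _ _ iv) => //.
- exact/measurable_EFinP.
- by move=> x _ /=; rewrite lee_fin (le_trans (uv x))// ler_norm.
Qed.

Lemma itgD u v : itg u -> itg v -> itg (fun x => u x + v x).
Proof. by move=> iu iv; exact: (integrableD measurableT iu iv). Qed.

Lemma itgZ c u : itg u -> itg (fun x => c * u x).
Proof. by move=> iu; exact: (integrableZl measurableT c iu). Qed.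

Lemma itg_norm u : itg u -> itg (fun x => `|u x|).
Proof. by move=> iu; exact: integrable_norm. Qed.

Lemma itg_measurable u : itg u -> measurable_fun setT u.
Proof. by move=> /measurable_int/measurable_EFinP. Qed.

Lemma itg_sum (I : Type) (s : seq I) (u : I -> T -> R) :
  (forall i, itg (u i)) -> itg (fun x => \sum_(i <- s) u i x).
Proof.
move=> iu; have := @integrable_sum _ _ _ mu setT measurableT I s xpredT
  (fun i => EFin \o u i) (fun i _ => iu i).
congr (integrable _ _ _); apply/funext => x /=; exact: sumEFin.
Qed.

Lemma Rintegral_sum (I : Type) (s : seq I) (u : I -> T -> R) :
  (forall i, itg (u i)) ->
  \int[mu]_x (\sum_(i <- s) u i x) = \sum_(i <- s) \int[mu]_x u i x.
Proof.
move=> iu; elim: s => [|i s IHs].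
  rewrite big_nil; under eq_Rintegral do rewrite big_nil.
  by rewrite Rintegral_cst// mul0r.
rewrite big_cons -IHs -RintegralD//; [|exact: iu|exact: itg_sum].
by apply: eq_Rintegral => x _; rewrite big_cons.
Qed.

Definition sqint u := measurable_fun setT u /\ itg (fun x => u x ^+ 2).

Definition ip u v : R := \int[mu]_x (u x * v x).

Lemma sqint_itgM u v : sqint u -> sqint v -> itg (fun x => u x * v x).
Proof.
move=> [mu_ iu] [mv iv]; apply: (dominated_itg _ (itgD iu iv)).
  exact: measurable_funM.
move=> x; rewrite normrM -(real_normK (num_real (u x))).
by rewrite -(real_normK (num_real (v x))); nra.
Qed.

Lemma sqint_lin c u v : sqint u -> sqint v -> sqint (fun x => c * u x + v x).
Proof.
move=> su sv; split.
  apply: measurable_funD; last by case: sv.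
  by apply: measurable_funM => //; case: su.
have := itgD (itgD (itgZ (c ^+ 2) su.2) (itgZ (2 * c) (sqint_itgM su sv))) sv.2.
by congr itg; apply/funext => x; ring.
Qed.

Lemma ipC u v : ip u v = ip v u.
Proof. by apply: eq_Rintegral => x _; rewrite mulrC. Qed.

Lemma ip_linl c u v w : sqint u -> sqint v -> sqint w ->
  ip (fun x => c * u x + v x) w = c * ip u w + ip v w.
Proof.
move=> su sv sw; rewrite /ip -RintegralZl//; last exact: sqint_itgM.
rewrite -RintegralD//; [|exact: itgZ (sqint_itgM su sw)|exact: sqint_itgM].
by apply: eq_Rintegral => x _; ring.
Qed.

Lemma ipZl c u v : sqint u -> sqint v -> ip (fun x => c * u x) v = c * ip u v.
Proof.
move=> su sv; rewrite /ip -RintegralZl//; last exact: sqint_itgM.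
by apply: eq_Rintegral => x _; rewrite mulrA.
Qed.

Lemma ipNl u v : sqint u -> sqint v -> ip (fun x => - u x) v = - ip u v.
Proof.
move=> su sv; rewrite -mulN1r -ipZl//.
by congr ip; apply/funext => x; rewrite mulN1r.
Qed.

Lemma ipNr u v : sqint u -> sqint v -> ip u (fun x => - v x) = - ip u v.
Proof. by move=> su sv; rewrite ipC ipNl// ipC. Qed.

Lemma ip_suml (I : Type) (s : seq I) (u : I -> T -> R) v :
  (forall i, sqint (u i)) -> sqint v ->
  ip (fun x => \sum_(i <- s) u i x) v = \sum_(i <- s) ip (u i) v.
Proof.
move=> su sv; rewrite -Rintegral_sum; last by move=> i; exact: sqint_itgM.
by apply: eq_Rintegral => x _; rewrite mulr_suml.
Qed.

Lemma ip_ge0 u : 0 <= ip u u.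
Proof. by apply: Rintegral_ge0 => x _; rewrite -expr2 sqr_ge0. Qed.

(** Elements of L^2(A) are extended by zero, so that the spaces for nested sets are themselves
    nested and every integral runs over the whole space. *)
Definition L2on A u := sqint u /\ forall x, ~ A x -> u x = 0.

Lemma L2on_lin A c u v : L2on A u -> L2on A v ->
  L2on A (fun x => c * u x + v x).
Proof.
move=> [su uA] [sv vA]; split; first exact: sqint_lin.
by move=> x Ax; rewrite uA// vA// mulr0 addr0.
Qed.

Lemma sqint0 : sqint (fun=> 0).
Proof.
split=> //; have := @integrable0 _ _ _ mu setT.
by congr (integrable _ _ _); apply/funext => x; rewrite /= expr0n.
Qed.

Lemma L2on0 A : L2on A (fun=> 0).
Proof. by split=> //; exact: sqint0. Qed.

Lemma L2onZ A c u : L2on A u -> L2on A (fun x => c * u x).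
Proof.
by move=> uA; have := L2on_lin c uA (L2on0 A); under eq_fun do rewrite addr0.
Qed.

Lemma L2on_sum A (I : Type) (s : seq I) (u : I -> T -> R) :
  (forall i, L2on A (u i)) -> L2on A (fun x => \sum_(i <- s) u i x).
Proof.
move=> uA; elim: s => [|i s IHs].
  by under eq_fun do rewrite big_nil; exact: L2on0.
by under eq_fun do rewrite big_cons -[u i _]mul1r; exact: L2on_lin.
Qed.

Lemma L2onW A A' u : A `<=` A' -> L2on A u -> L2on A' u.
Proof. by move=> AA' [su uA]; split=> // x A'x; apply: uA => /AA'. Qed.

Lemma L2on_restrict A A' u : measurable A' -> L2on A u ->
  L2on (A `&` A') (fun x => \1_A' x * u x).
Proof.
move=> mA' [[mu_ iu] uA]; split; first split.
- by apply: measurable_funM => //; exact: measurable_indic.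
- apply: (dominated_itg _ iu).
    by apply: measurable_funX; apply: measurable_funM.
  move=> x; rewrite ger0_norm ?sqr_ge0// indicE; case: (_ \in _);
    by rewrite ?mul1r// mul0r expr0n/= sqr_ge0.
- move=> x /not_andP; rewrite indicE; case: (boolP (x \in A')) => [|_ _].
    by rewrite inE => A'x [/uA->|//]; rewrite mulr0.
  by rewrite mul0r.
Qed.

Lemma itg_indic A : measurable A -> (mu A < +oo)%E -> itg \1_A.
Proof.
move=> mA Aoo; apply/integrableP; split.
  by apply/measurable_EFinP; exact: measurable_indic.
rewrite (eq_integral (fun x => (\1_A x)%:E)) ?integral_indic ?setIT//.
by move=> x _; rewrite /= ger0_norm.
Qed.

Lemma itg_cst_on A C : measurable A -> (mu A < +oo)%E ->
  itg (fun x => C * \1_A x).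
Proof. by move=> mA Aoo; apply/itgZ/itg_indic. Qed.

Lemma L2on_itg A u : measurable A -> (mu A < +oo)%E -> L2on A u -> itg u.
Proof.
move=> mA Aoo [[mu_ iu] uA].
apply: (dominated_itg mu_ (itgD (itg_cst_on 1 mA Aoo) iu)) => x.
have [Ax|Ax] := pselect (A x).
  rewrite indicE mem_set// mulr1 -(real_normK (num_real (u x))).
  by have := normr_ge0 (u x); nra.
by rewrite uA// normr0 expr0n/= addr0 mul1r indicE ler0n.
Qed.

Lemma bounded_L2on A u C : measurable A -> (mu A < +oo)%E ->
  measurable_fun setT u -> (forall x, `|u x| <= C * \1_A x) -> L2on A u.
Proof.
move=> mA Aoo mu_ uC; split; first split=> //.
  apply: (dominated_itg _ (itg_cst_on (C ^+ 2) mA Aoo)).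
    exact: measurable_funX.
  move=> x; rewrite normrX; apply: (le_trans (lerXn2r 2 _ _ (uC x))).
  - by rewrite nnegrE.
  - by rewrite nnegrE (le_trans _ (uC x)).
  - by rewrite exprMn indicE; case: (_ \in _); rewrite ?expr1n ?expr0n.
move=> x Ax; have := uC x; rewrite indicE memNset// mulr0.
by rewrite normr_le0 => /eqP.
Qed.

Definition norm1 u : R := \int[mu]_x `|u x|.

Lemma norm1_ge0 u : 0 <= norm1 u.
Proof. exact: Rintegral_ge0. Qed.

(** Cauchy-Schwarz for |u| and the indicator of [A], read off from the nonnegativity in t of the
    integral of (|u| + t)^2 over [A]. The factor [mu A] is the source of all smallness on short
    intervals. *)
Lemma sqr_norm1_le A u : measurable A -> (mu A < +oo)%E -> L2on A u ->
  norm1 u ^+ 2 <= fine (mu A) * ip u u.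
Proof.
move=> mA Aoo Au.
have iA := itg_cst_on 1 mA Aoo; have iu := itg_norm (L2on_itg mA Aoo Au).
have iu2 := Au.1.2.
have key t : 0 <= ip u u + t * norm1 u *+ 2 + t ^+ 2 * fine (mu A).
  have -> : ip u u + t * norm1 u *+ 2 + t ^+ 2 * fine (mu A) =
    \int[mu]_x (u x ^+ 2 + (2 * t) * `|u x| + t ^+ 2 * \1_A x).
    rewrite RintegralD//; first last.
    - exact: itg_cst_on.
    - exact: itgD iu2 (itgZ _ iu).
    rewrite RintegralD//; last exact: itgZ iu.
    rewrite !RintegralZl//; last exact: itg_indic.
    rewrite {3}/Rintegral integral_indic// setIT.
    have -> : \int[mu]_x u x ^+ 2 = ip u u.
      by apply: eq_Rintegral => x _; rewrite expr2.
    by rewrite /norm1; ring.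
  apply: Rintegral_ge0 => x _; have [Ax|Ax] := pselect (A x).
    rewrite indicE mem_set// mulr1 -(real_normK (num_real (u x))).
    by have := sqr_ge0 (`|u x| + t); nra.
  by rewrite Au.2// normr0 indicE memNset// mulr0 expr0n/= addr0 mulr0 addr0.
(* On a null set the polynomial in t is affine, and a nonzero slope would make it negative
   somewhere; otherwise it is evaluated at its minimum. *)
have [A0|A0] := eqVneq (fine (mu A)) 0.
  move: key; rewrite A0 mul0r => key.
  suff : norm1 u <= 0 by move: (norm1_ge0 u); nra.
  rewrite leNgt; apply/negP => u0.
  have := key (- (ip u u + 1) / norm1 u); rewrite mulr0 addr0 mulfVK ?gt_eqF//.
  by have := ip_ge0 u; lra.
have Apos : 0 < fine (mu A) by rewrite lt_def A0/= fine_ge0.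
have := key (- norm1 u / fine (mu A)).
set m := fine _ in Apos *; set n := norm1 u.
have -> : ip u u + - n / m * n *+ 2 + (- n / m) ^+ 2 * m = ip u u - n ^+ 2 / m.
  by field; rewrite gt_eqF.
by rewrite subr_ge0 ler_pdivrMr// mulrC.
Qed.

End SquareIntegrable.

(** * Integral operators with bounded kernel *)

(** Integrability is not assumed: the integral is the difference of those of the positive and
    negative parts, each measurable in the parameter by Tonelli. *)
Lemma measurable_Rintegral d1 d2 (T1 : measurableType d1)
    (T2 : measurableType d2) (R : realType)
    (mu : {sigma_finite_measure set T2 -> \bar R}) (w : T1 * T2 -> R) :
  measurable_fun setT w ->
  measurable_fun setT (fun x => \int[mu]_y w (x, y)).
Proof.
move=> mw; apply: measurableT_comp; first exact: fine_measurable.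
have mEw : measurable_fun setT (EFin \o w) by exact/measurable_EFinP.
have -> : (fun x => \int[mu]_y (w (x, y))%:E)%E =
    (fubini_F mu (EFin \o w)^\+ \- fubini_F mu (EFin \o w)^\-)%E.
  apply/funext => x; rewrite [LHS]integralE; congr (_ - _)%E;
    by apply: eq_integral => y _; rewrite ?funeposE ?funenegE.
apply: emeasurable_funB.
  by apply: measurable_fun_fubini_tonelli_F => //; exact: measurable_funepos.
by apply: measurable_fun_fubini_tonelli_F => //; exact: measurable_funeneg.
Qed.

Section IntegralOperator.
Context d (T : measurableType d) (R : realType).
Variable mu : {sigma_finite_measure set T -> \bar R}.
Variables (A : set T) (C : R).
Hypotheses (C0 : 0 <= C) (mA : measurable A) (Aoo : (mu A < +oo)%E).
Implicit Types (u v w : T -> R) (k : T * T -> R).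

Definition bkernel k := measurable_fun setT k /\
  forall x y, `|k (x, y)| <= C * \1_A x * \1_A y.

Definition kop k u (x : T) : R := \int[mu]_y (k (x, y) * u y).

Lemma bkernel_itg k x u : bkernel k -> L2on mu A u ->
  itg mu (fun y => k (x, y) * u y).
Proof.
move=> kC Au; have iu := itg_norm (L2on_itg mA Aoo Au).
apply: (dominated_itg _ (itgZ (C * \1_A x) iu)).
  apply: measurable_funM; last by case: Au.1.
  exact: measurableT_comp kC.1 (measurable_pair1 _).
move=> y; rewrite normrM ler_wpM2r//; apply: (le_trans (kC.2 x y)).
by rewrite ler_piMr ?mulr_ge0// indicE lern1 leq_b1.
Qed.

Lemma kop_lin k c u v x : bkernel k -> L2on mu A u -> L2on mu A v ->
  kop k (fun y => c * u y + v y) x = c * kop k u x + kop k v x.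
Proof.
move=> kC Au Av; rewrite /kop -RintegralZl//; last exact: bkernel_itg.
rewrite -RintegralD//; first last.
- exact: bkernel_itg.
- exact: itgZ (bkernel_itg _ kC Au).
by apply: eq_Rintegral => y _; ring.
Qed.

Lemma kop_bound k u x : bkernel k -> L2on mu A u ->
  `|kop k u x| <= C * norm1 mu u * \1_A x.
Proof.
move=> kC Au; have iu := itg_norm (L2on_itg mA Aoo Au).
apply: le_trans (le_normr_Rintegral measurableT (bkernel_itg x kC Au)) _.
rewrite mulrAC -RintegralZl//; apply: le_Rintegral => //.
- exact: itg_norm (bkernel_itg x kC Au).
- exact: itgZ iu.
move=> y _; rewrite normrM ler_wpM2r//; apply: (le_trans (kC.2 x y)).
by rewrite ler_piMr ?mulr_ge0// indicE lern1 leq_b1.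
Qed.

Lemma measurable_kop k u : bkernel k -> measurable_fun setT u ->
  measurable_fun setT (kop k u).
Proof.
move=> kC mu_; apply: (@measurable_Rintegral _ _ _ _ _ mu
  (fun z => k z * u z.2)).
apply: measurable_funM; first exact: kC.1.
exact: measurableT_comp mu_ measurable_snd.
Qed.

Lemma kop_L2on k u : bkernel k -> L2on mu A u -> L2on mu A (kop k u).
Proof.
move=> kC Au; apply: (@bounded_L2on _ _ _ _ _ _ (C * norm1 mu u)) => //.
  by apply: measurable_kop => //; case: Au.1.
by move=> x; exact: kop_bound.
Qed.

Lemma ip_kop_bound k u v : bkernel k -> L2on mu A u -> L2on mu A v ->
  `|ip mu (kop k u) v| <= C * norm1 mu u * norm1 mu v.
Proof.
move=> kC Au Av; have ikuv := sqint_itgM (kop_L2on kC Au).1 Av.1.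
apply: le_trans (le_normr_Rintegral measurableT ikuv) _.
have iv := itg_norm (L2on_itg mA Aoo Av).
rewrite -RintegralZl//; apply: le_Rintegral => //.
- exact: itg_norm.
- exact: itgZ.
move=> x _; rewrite normrM ler_wpM2r//; apply: (le_trans (kop_bound x kC Au)).
by rewrite ler_piMr ?mulr_ge0 ?norm1_ge0// indicE lern1 leq_b1.
Qed.

(** Fubini: the adjoint of an integral operator has the transposed kernel. *)
Lemma ip_kop_swap k u v : bkernel k -> L2on mu A u -> L2on mu A v ->
  ip mu (kop k u) v = ip mu (kop (k \o swap_pair) v) u.
Proof.
move=> kC Au Av.
have kCs : bkernel (k \o swap_pair).
  split; first exact: measurableT_comp kC.1 (@measurable_swap _ _ T T).
  by move=> x y; rewrite mulrAC; exact: kC.2.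
pose f z := k z * u z.2 * v z.1.
have mf : measurable_fun setT (EFin \o f).
  apply/measurable_EFinP; apply: measurable_funM; first apply: measurable_funM.
  - exact: kC.1.
  - exact: measurableT_comp Au.1.1 measurable_snd.
  - exact: measurableT_comp Av.1.1 measurable_fst.
have if1 x : itg mu (fun y => f (x, y)).
  have := itgZ (v x) (bkernel_itg x kC Au).
  by congr itg; apply/funext => y; rewrite /f mulrC.
(* Integrating in y first leaves at most C |u|_1 |v(x)|, and [v] is integrable because [A] has
   finite measure. *)
have ifz : (mu \x mu)%E.-integrable setT (EFin \o f).
  apply/(integrable12ltyP mu mu mf).
  have iv := itg_norm (L2on_itg mA Aoo Av).
  apply: (@le_lt_trans _ _ (\int[mu]_x (C * norm1 mu u * `|v x|)%:E)%E).
    apply: ge0_le_integral => //.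
    - by move=> x _; exact: integral_ge0.
    - apply: (measurable_fun_fubini_tonelli_F (abse \o (EFin \o f))) => //=.
      exact: measurableT_comp.
    - by apply/measurable_EFinP; exact: itg_measurable (itgZ _ iv).
    move=> x _; rewrite -[leLHS]fineK ?lee_fin; last first.
      exact: integrable_fin_num (itg_norm (if1 x)).
    have iu := itg_norm (L2on_itg mA Aoo Au).
    rewrite mulrAC -RintegralZl//; apply: le_Rintegral => //.
    - exact: itg_norm (if1 x).
    - exact: itgZ iu.
    move=> y _; rewrite !normrM mulrAC ler_wpM2r// ler_wpM2r//.
    apply: (le_trans (kC.2 x y)); rewrite -mulrA ler_piMr//.
  by have /integrable_lty := itgZ (C * norm1 mu u) iv; apply.
have /(congr1 fine) := Fubini ifz; rewrite /= /ip /kop => fE.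
transitivity (\int[mu]_x \int[mu]_y f (x, y)).
  apply: eq_Rintegral => x _; rewrite -RintegralZr//; exact: bkernel_itg.
transitivity (\int[mu]_y \int[mu]_x f (x, y)); last first.
  apply: eq_Rintegral => y _.
  rewrite -RintegralZr//; last exact: (bkernel_itg _ kCs).
  by apply: eq_Rintegral => x _; rewrite /f/= mulrAC.
have if2 y : itg mu (fun x => f (x, y)).
  have := itgZ (u y) (bkernel_itg y kCs Av).
  by congr itg; apply/funext => x; rewrite /f/= mulrCA mulrA mulrAC.
transitivity (fine (\int[mu]_x \int[mu]_y (f (x, y))%:E)%E).
  congr fine; apply: eq_integral => x _; rewrite fineK//.
  exact: integrable_fin_num (if1 x).
rewrite fE; congr fine; apply: eq_integral => y _; rewrite fineK//.
exact: integrable_fin_num (if2 y).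
Qed.

End IntegralOperator.

(** * Quadratic forms *)

(** Here [fF], [fG] stand for a form at F and at G = S F, and [nF], [nG] for the squared norms; the
    last hypothesis is nonnegativity of the form at F - G / M, with the mixed term equal to [nG]. It
    yields nG <= M fF, hence nF <= K M fF, and the added 1 keeps the constant invertible when [K] is
    0. It serves both the operators and the constant matrix. *)
Lemma coercive_of_discrepancy (R : realFieldType) (fF fG nF nG K M : R) :
  0 < M -> 0 <= K -> 0 <= fF -> fG <= M * nG -> nF <= K * nG ->
  0 <= M^-1 ^+ 2 * fG - 2 * M^-1 * nG + fF -> (K * M + 1)^-1 * nF <= fF.
Proof.
move=> M0 K0 fF0 fGM nFK h.
have KM0 : 0 < K * M + 1 by rewrite ltr_wpDl// mulr_ge0// ltW.
have h1 : M^-1 ^+ 2 * fG <= M^-1 * nG.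
  rewrite expr2 -mulrA ler_wpM2l ?invr_ge0 ?(ltW M0)//.
  by rewrite ler_pdivrMl.
have h2 : M^-1 * nG <= fF by lra.
move: h2; rewrite ler_pdivrMl// => h3; rewrite ler_pdivrMl//.
rewrite mulrDl mul1r -mulrA.
by have := ler_wpM2l K0 h3; lra.
Qed.

Section QuadraticForm.
Context d (T : measurableType d) (R : realType).
Variable mu : {sigma_finite_measure set T -> \bar R}.
Variable P : finType.
Implicit Types (F G H : P -> T -> R).

Definition vL2on A F := forall p, L2on mu A (F p).

Definition vip F G : R := \sum_p ip mu (F p) (G p).

Definition vlin (c : R) F G p x := c * F p x + G p x.

Definition vcut A F p x : R := \1_A x * F p x.

Lemma vipC F G : vip F G = vip G F.
Proof. by apply: eq_bigr => p _; exact: ipC. Qed.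

Lemma vip_ge0 F : 0 <= vip F F.
Proof. by apply: sumr_ge0 => p _; exact: ip_ge0. Qed.

Lemma vip_linl A c F G H : vL2on A F -> vL2on A G -> vL2on A H ->
  vip (vlin c F G) H = c * vip F H + vip G H.
Proof.
move=> AF AG AH; rewrite /vip mulr_sumr -big_split/=; apply: eq_bigr => p _.
exact: ip_linl (AF p).1 (AG p).1 (AH p).1.
Qed.

Lemma vL2on_lin A c F G : vL2on A F -> vL2on A G -> vL2on A (vlin c F G).
Proof. by move=> AF AG p; exact: L2on_lin. Qed.

Lemma vL2on_cut A A' F : measurable A' -> vL2on A F ->
  vL2on (A `&` A') (vcut A' F).
Proof. by move=> mA' AF p; exact: L2on_restrict. Qed.

Lemma vL2onW A A' F : A `<=` A' -> vL2on A F -> vL2on A' F.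
Proof. by move=> AA' AF p; exact: L2onW (AF p). Qed.

Lemma vcutE A F x p : vcut A F p x = if x \in A then F p x else 0.
Proof. by rewrite /vcut indicE; case: (_ \in _); rewrite ?mul1r ?mul0r. Qed.

Lemma vip_disjoint A A' F G : vL2on A F -> vL2on A' G ->
  A `&` A' = set0 -> forall p q, ip mu (F p) (G q) = 0.
Proof.
move=> AF AG AA' p q; rewrite /ip -[RHS](Rintegral_set0 mu (fun=> 0)).
rewrite Rintegral_mkcond; apply/esym; rewrite Rintegral_mkcond.
apply: eq_Rintegral => x _; rewrite !patchE.
rewrite memNset//; rewrite in_setT.
have [Ax|Ax] := pselect (A x); last by rewrite (AF p).2// mul0r.
rewrite (AG q).2 ?mulr0// => A'x.
by have : (A `&` A') x by []; rewrite AA'.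
Qed.

Lemma ip_normr_le u v : sqint mu u -> sqint mu v ->
  `|ip mu u v| <= (ip mu u u + ip mu v v) / 2.
Proof.
move=> su sv; have := ip_ge0 mu (fun x => 1 * u x + v x).
have := ip_ge0 mu (fun x => -1 * u x + v x).
rewrite !ip_linl//; try exact: sqint_lin.
rewrite ![ip mu _ (fun x => _ + _)]ipC !ip_linl// (ipC _ v u) => h1 h2.
by rewrite ler_norml; lra.
Qed.

Variables (a : P -> P -> R) (k : P -> P -> T * T -> R) (A : set T) (C : R).
Hypotheses (C0 : 0 <= C) (mA : measurable A) (Aoo : (mu A < +oo)%E).
Hypothesis kC : forall p q, bkernel A C (k p q).

Definition opS F p x : R := \sum_q (a p q * F q x - kop mu (k p q) (F q) x).

Definition form F G : R := vip (opS F) G.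

Definition kform F G : R :=
  \sum_p \sum_q ip mu (kop mu (k p q) (F q)) (G p).

Lemma opS_lin c F G : vL2on A F -> vL2on A G ->
  opS (vlin c F G) = vlin c (opS F) (opS G).
Proof.
move=> AF AG; apply/funext => p; apply/funext => x.
rewrite /opS /vlin mulr_sumr -big_split/=; apply: eq_bigr => q _.
by rewrite (kop_lin C0 mA Aoo)//; ring.
Qed.

Lemma opS_L2on F : vL2on A F -> vL2on A (opS F).
Proof.
move=> AF p; apply: L2on_sum => q.
have := L2on_lin (-1) (kop_L2on C0 mA Aoo (kC p q) (AF q))
  (L2onZ (a p q) (AF q)).
by congr L2on; apply/funext => x; ring.
Qed.

Lemma formE F G : vL2on A F -> vL2on A G ->
  form F G = \sum_p \sum_q a p q * ip mu (F q) (G p) - kform F G.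
Proof.
move=> AF AG; rewrite /form /vip /kform -sumrB; apply: eq_bigr => p _.
have AkF q := kop_L2on C0 mA Aoo (kC p q) (AF q).
rewrite -sumrB ip_suml; last 2 first.
- move=> q; have := L2on_lin (-1) (AkF q) (L2onZ (a p q) (AF q)).
  by move=> /proj1; congr sqint; apply/funext => x; ring.
- by case: (AG p).
apply: eq_bigr => q _.
transitivity
  (ip mu (fun x => -1 * kop mu (k p q) (F q) x + a p q * F q x) (G p)).
  by congr ip; apply/funext => x; ring.
rewrite (ip_linl _ (AkF q).1 (L2onZ _ (AF q)).1 (AG p).1).
by rewrite (ipZl _ (AF q).1 (AG p).1); ring.
Qed.

Lemma form_linl c F G H : vL2on A F -> vL2on A G -> vL2on A H ->
  form (vlin c F G) H = c * form F H + form G H.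
Proof.
move=> AF AG AH.
by rewrite /form opS_lin// (vip_linl _ (opS_L2on _) (opS_L2on _)).
Qed.

Hypothesis aC : forall p q, a p q = a q p.
Hypothesis kS : forall p q x y, k p q (x, y) = k q p (y, x).

Lemma formC F G : vL2on A F -> vL2on A G -> form F G = form G F.
Proof.
move=> AF AG; rewrite !formE//; congr (_ - _).
  rewrite exchange_big; apply: eq_bigr => p _; apply: eq_bigr => q _.
  by rewrite aC ipC.
rewrite /kform exchange_big; apply: eq_bigr => p _; apply: eq_bigr => q _.
have kE : k q p \o swap_pair = k p q by apply/funext => -[x y]; exact: kS.
by have := ip_kop_swap C0 mA Aoo (kC q p) (AF p) (AG q); rewrite kE.
Qed.

Lemma form_sqr c F G : vL2on A F -> vL2on A G ->
  form (vlin c F G) (vlin c F G) =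
  c ^+ 2 * form F F + 2 * c * form F G + form G G.
Proof.
move=> AF AG; have AFG := vL2on_lin c AF AG.
rewrite (form_linl _ AF AG AFG) (formC AF AFG) (formC AG AFG).
rewrite (form_linl _ AF AG AF) (form_linl _ AF AG AG) (formC AG AF).
by move: (form F F) (form F G) (form G G) => x y z; ring.
Qed.

(** Each entry is bounded by a product of L^1 norms, which Young's inequality with weight [e]
    splits, before Cauchy-Schwarz brings in the measures. The cardinality of [P] appears because
    each square depends on only one of the two summation indices. *)
Lemma kform_le e A1 A2 F G : 0 < e -> measurable A1 -> measurable A2 ->
  A1 `<=` A -> A2 `<=` A -> vL2on A1 F -> vL2on A2 G ->
  `|kform F G| <= C * #|P|%:R *
    (e * fine (mu A1) * vip F F + e^-1 * fine (mu A2) * vip G G) / 2.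
Proof.
move=> e0 mA1 mA2 A1A A2A A1F A2G.
have fin B : measurable B -> B `<=` A -> (mu B < +oo)%E.
  by move=> mB BA; apply: le_lt_trans Aoo; rewrite le_measure ?inE.
have L B H : measurable B -> B `<=` A -> vL2on B H ->
    \sum_p norm1 mu (H p) ^+ 2 <= fine (mu B) * vip H H.
  move=> mB BA BH; rewrite /vip mulr_sumr; apply: ler_sum => p _.
  exact: sqr_norm1_le (fin _ mB BA) (BH p).
have AF := vL2onW A1A A1F; have AG := vL2onW A2A A2G.
have LF := L _ _ mA1 A1A A1F; have LG := L _ _ mA2 A2A A2G.
apply: (@le_trans _ _ (\sum_p \sum_q C * (e * norm1 mu (F q) ^+ 2 +
    e^-1 * norm1 mu (G p) ^+ 2) / 2)).
  apply: (le_trans (ler_norm_sum _ _ _)); apply: ler_sum => p _.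
  apply: (le_trans (ler_norm_sum _ _ _)); apply: ler_sum => q _.
  apply: (le_trans (ip_kop_bound C0 mA Aoo (kC p q) (AF q) (AG p))).
  rewrite -!mulrA ler_wpM2l//.
  set x := norm1 _ _; set y := norm1 _ _.
  have -> : e * x ^+ 2 + e^-1 * y ^+ 2 = e * (x - y / e) ^+ 2 + 2 * (x * y).
    by field; rewrite gt_eqF.
  have := mulr_ge0 (ltW e0) (sqr_ge0 (x - y / e)); lra.
have -> : \sum_p \sum_q C * (e * norm1 mu (F q) ^+ 2 +
    e^-1 * norm1 mu (G p) ^+ 2) / 2 =
  C * #|P|%:R * (e * (\sum_q norm1 mu (F q) ^+ 2) +
    e^-1 * (\sum_q norm1 mu (G q) ^+ 2)) / 2.
  set X := \sum_q norm1 mu (F q) ^+ 2.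
  transitivity (\sum_p (C * e / 2 * X +
      C * e^-1 / 2 * #|P|%:R * norm1 mu (G p) ^+ 2)).
    apply: eq_bigr => p _; rewrite /X mulr_sumr.
    under eq_bigr do rewrite -mulrA mulrDl mulrDr.
    rewrite big_split/= sumr_const -mulr_natr; congr (_ + _); last by ring.
    by apply: eq_bigr => q _; ring.
  by rewrite big_split/= sumr_const -mulr_natr -mulr_sumr; ring.
rewrite ler_wpM2r ?invr_ge0// ler_wpM2l ?mulr_ge0//.
by rewrite -!mulrA lerD// ler_wpM2l ?invr_ge0 ?(ltW e0).
Qed.

Lemma form_bounded : exists2 M, 0 < M &
  forall F, vL2on A F -> form F F <= M * vip F F.
Proof.
pose M0 := \sum_p \sum_q `|a p q|.
have M00 : 0 <= M0 by apply: sumr_ge0 => p _; apply: sumr_ge0.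
pose m := C * #|P|%:R * fine (mu A).
have m0 : 0 <= m by rewrite !mulr_ge0 ?fine_ge0.
exists (M0 + m + 1); first by rewrite ltr_wpDl ?addr_ge0.
move=> F AF; rewrite formE//.
have : \sum_p \sum_q a p q * ip mu (F q) (F p) <= M0 * vip F F.
  rewrite mulr_suml; apply: ler_sum => p _; rewrite mulr_suml.
  apply: ler_sum => q _; apply: (le_trans (ler_norm _)).
  rewrite normrM ler_wpM2l//.
  apply: (le_trans (ip_normr_le (AF q).1 (AF p).1)).
  have le1 r : ip mu (F r) (F r) <= vip F F.
    rewrite /vip (bigD1 r)//= lerDl; apply: sumr_ge0 => s _; exact: ip_ge0.
  by have := le1 p; have := le1 q; lra.
have := kform_le ltr01 mA mA (@subset_refl _ A) (@subset_refl _ A) AF AF.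
rewrite ler_norml invr1 !mul1r => /andP[+ _].
have -> : C * #|P|%:R * (fine (mu A) * vip F F + fine (mu A) * vip F F) / 2 =
  m * vip F F by rewrite /m; field.
by have := vip_ge0 F; rewrite !mulrDl mul1r; lra.
Qed.

(* Evaluating the form at [F - G / M], where [G] is the compression of [opS F]
   to [A'], gives [0 <= form F F - vip G G / M]. *)
Lemma strictly_positive_form A' K : measurable A' -> A' `<=` A -> 0 <= K ->
  (forall F, vL2on A' F -> 0 <= form F F) ->
  (forall F, vL2on A' F ->
    vip F F <= K * vip (vcut A' (opS F)) (vcut A' (opS F))) ->
  exists2 delta, 0 < delta &
    forall F, vL2on A' F -> delta * vip F F <= form F F.
Proof.
move=> mA' A'A K0 pos FK; have [M M0 formM] := form_bounded.
have KM0 : 0 < K * M + 1 by rewrite ltr_wpDl// mulr_ge0// ltW.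
exists (K * M + 1)^-1; first by rewrite invr_gt0.
move=> F A'F; set G := vcut A' (opS F) in FK *.
have AF := vL2onW A'A A'F.
have A'G : vL2on A' G.
  have := vL2on_cut mA' (opS_L2on AF).
  by apply: vL2onW; exact: subIsetr.
have AG := vL2onW A'A A'G.
have FG : form F G = vip G G.
  apply: eq_bigr => p _; apply: eq_Rintegral => x _; rewrite /G vcutE.
  by case: ifPn => // _; rewrite !mulr0.
have := pos _ (vL2on_lin (- M^-1) A'G A'F).
rewrite form_sqr// (formC AG AF) FG.
rewrite mulrN mulNr sqrrN.
exact: (coercive_of_discrepancy M0 K0 (pos _ A'F) (formM _ AG) (FK _ A'F)).
Qed.

Variable alpha : R.
Hypothesis a_coercive : forall v : P -> R,
  alpha * \sum_p v p ^+ 2 <= \sum_p \sum_q a p q * (v q * v p).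

(** The pointwise coercivity of the matrix is integrated, so only the kernel can spoil
    positivity. *)
Lemma form_coercive F : vL2on A F -> alpha * vip F F - kform F F <= form F F.
Proof.
move=> AF; rewrite formE// lerD2r.
have iF p q : itg mu (fun x => F p x * F q x).
  exact: sqint_itgM (AF p).1 (AF q).1.
have -> : alpha * vip F F = \int[mu]_x (alpha * \sum_p F p x ^+ 2).
  rewrite RintegralZl//; last by apply: itg_sum => p; exact: (AF p).1.2.
  rewrite Rintegral_sum; last by move=> p; exact: (AF p).1.2.
  by congr (_ * _); apply: eq_bigr => p _; apply: eq_Rintegral => x _.
have -> : \sum_p \sum_q a p q * ip mu (F q) (F p) =
    \int[mu]_x \sum_p \sum_q a p q * (F q x * F p x).
  rewrite Rintegral_sum; last by move=> p; apply: itg_sum => q; exact: itgZ.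
  apply: eq_bigr => p _; rewrite Rintegral_sum; last by move=> q; exact: itgZ.
  by apply: eq_bigr => q _; rewrite RintegralZl//; exact: iF.
apply: le_Rintegral => //.
- by apply/itgZ/itg_sum => p; exact: (AF p).1.2.
- by apply: itg_sum => p; apply: itg_sum => q; exact: itgZ.
Qed.

(** Multiplication by a constant matrix does not couple functions with disjoint supports. In 1 + 1/e
    the summand 1 pays for the kernel inside [A2] and 1/e for the share of [A2] in the cross term.
    The share of [A1] is stated with the measure of [A], so that it does not depend on where the cut
    is made. *)
Lemma form_split_ge e A1 A2 F : 0 < e -> measurable A1 -> measurable A2 ->
  A1 `<=` A -> A2 `<=` A -> A1 `&` A2 = set0 -> vL2on (A1 `|` A2) F ->
  form (vcut A1 F) (vcut A1 F) +
  (alpha - C * #|P|%:R * (1 + e^-1) * fine (mu A2)) *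
    vip (vcut A2 F) (vcut A2 F) -
  C * #|P|%:R * e * fine (mu A) * vip (vcut A1 F) (vcut A1 F) <= form F F.
Proof.
move=> e0 mA1 mA2 A1A A2A A12 AF.
set F1 := vcut A1 F; set F2 := vcut A2 F.
have FE : F = vlin 1 F1 F2.
  apply/funext => p; apply/funext => x; rewrite /vlin /F1 /F2 !vcutE mul1r.
  have [A1x|A1x] := boolP (x \in A1); have [A2x|A2x] := boolP (x \in A2).
  - have : (A1 `&` A2) x by split; rewrite -inE.
    by rewrite A12.
  - by rewrite addr0.
  - by rewrite add0r.
  - rewrite addr0 (AF p).2// => -[|].
      by rewrite -inE (negPf A1x).
    by rewrite -inE (negPf A2x).
have A1F : vL2on A1 F1.
  by have := vL2on_cut mA1 AF; apply: vL2onW; exact: subIsetr.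
have A2F : vL2on A2 F2.
  by have := vL2on_cut mA2 AF; apply: vL2onW; exact: subIsetr.
have AF1 := vL2onW A1A A1F; have AF2 := vL2onW A2A A2F.
rewrite FE form_sqr// expr1n mul1r mulr1.
have : - (2 * form F1 F2) <= C * #|P|%:R *
    (e * fine (mu A1) * vip F1 F1 + e^-1 * fine (mu A2) * vip F2 F2).
  rewrite formE//.
  rewrite [X in X - _]big1 ?sub0r; last first.
    move=> p _; rewrite big1// => q _.
    by rewrite (vip_disjoint A1F A2F)// mulr0.
  have := kform_le e0 mA1 mA2 A1A A2A A1F A2F.
  rewrite ler_norml => /andP[_]; lra.
have := kform_le ltr01 mA2 mA2 A2A A2A A2F A2F.
rewrite ler_norml invr1 !mul1r => /andP[_].
have := form_coercive AF2.
have : C * #|P|%:R * (e * fine (mu A1) * vip F1 F1) <=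
       C * #|P|%:R * e * fine (mu A) * vip F1 F1.
  rewrite mulrA ler_wpM2r ?vip_ge0// mulrA ler_wpM2l ?mulr_ge0 ?(ltW e0)//.
  apply: fine_le.
  - by rewrite ge0_fin_numE//; apply: le_lt_trans Aoo; rewrite le_measure ?inE.
  - by rewrite ge0_fin_numE.
  - by rewrite le_measure ?inE.
move: (form F1 F1) (form F1 F2) (form F2 F2) (kform F2 F2) (C * #|P|%:R).
move: (vip F1 F1) (vip F2 F2) (fine (mu A1)) (fine (mu A2)) (fine (mu A)).
move=> n1 n2 a1 a2 m f11 f12 f22 k22 c h1 h2 h3 h4.
have -> : (alpha - c * (1 + e^-1) * a2) * n2 =
  alpha * n2 - c * (a2 * n2 + a2 * n2) / 2 - c * (e^-1 * a2 * n2).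
  by field; rewrite gt_eqF.
by move: h4; rewrite mulrDr; lra.
Qed.

End QuadraticForm.

(** * Continuation in the length of the interval *)

Section Continuation.
Context {R : realType} {P : finType}.
Notation mu := (@lebesgue_measure R).
Variables (l C alpha : R) (a : P -> P -> R).
Variable k : P -> P -> measurableTypeR R * measurableTypeR R -> R.
Hypotheses (l0 : 0 < l) (C0 : 0 <= C) (alpha0 : 0 < alpha).
Hypothesis kC : forall p q, bkernel `]0, l[ C (k p q).
Hypothesis aC : forall p q, a p q = a q p.
Hypothesis kS : forall p q x y, k p q (x, y) = k q p (y, x).
Hypothesis a_coercive : forall v : P -> R,
  alpha * \sum_p v p ^+ 2 <= \sum_p \sum_q a p q * (v q * v p).
Implicit Types (F : P -> measurableTypeR R -> R) (r s e : R).

Notation Q := (form mu a k).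
Notation N := (vip mu).

Let c := C * #|P|%:R.

Let c_ge0 : 0 <= c. Proof. exact: mulr_ge0. Qed.

Lemma measurable_oo0 r : measurable (`]0, r[%classic : set (measurableTypeR R)).
Proof. exact: measurable_itv. Qed.

Lemma lebesgue_measure_oo0 r : 0 <= r -> mu `]0, r[ = r%:E.
Proof.
rewrite le_eqVlt => /predU1P[<-|r0]; rewrite lebesgue_measure_itv/= lte_fin.
  by rewrite ltxx.
by rewrite r0 -EFinB subr0.
Qed.

Lemma lebesgue_measure_oo0_lty r : (mu `]0%R, r[ < +oo)%E.
Proof.
by rewrite lebesgue_measure_itv/= lte_fin; case: ifP => _; rewrite ?ltry.
Qed.

Lemma vip_oo00 F G : vL2on mu `]0, 0[ F -> N F G = 0.
Proof.
move=> F0; rewrite /vip big1// => p _.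
rewrite /ip Rintegral_mkcond/= [X in Rintegral _ _ X](_ : _ = cst 0).
  by rewrite Rintegral_cst// mul0r.
apply/funext => x; rewrite patchE in_setT (F0 p).2 ?mul0r//=.
by rewrite in_itv/= => /andP[/lt_trans/[apply]]; rewrite ltxx.
Qed.

Lemma vip_cut_le (D A : set (measurableTypeR R)) F :
  measurable A -> vL2on mu D F ->
  N (vcut A F) (vcut A F) <= N F F.
Proof.
move=> mA DF; have AF := vL2on_cut mA DF.
apply: ler_sum => p _; apply: le_Rintegral => //.
- exact: sqint_itgM (AF p).1 (AF p).1.
- exact: sqint_itgM (DF p).1 (DF p).1.
by move=> x _; rewrite vcutE; case: ifP => // _; rewrite mulr0 -expr2 sqr_ge0.
Qed.

Lemma form_cut_ge r s e F : 0 <= r -> r <= s -> s <= l -> 0 < e ->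
  c * (1 + e^-1) * (s - r) <= alpha -> vL2on mu `]0, s[ F ->
  Q (vcut `]0, r[ F) (vcut `]0, r[ F) -
    c * e * l * N (vcut `]0, r[ F) (vcut `]0, r[ F) <= Q F F.
Proof.
move=> r0 rs sl e0 small sF.
(* The intersection removes the point 0 when [r] is 0, so that [A2] stays inside the open interval
   (0, l). *)
pose A2 : set (measurableTypeR R) := `]0, s[%classic `&` `[r, s[%classic.
have mA2 : measurable A2 by apply: measurableI.
have lA2 : fine (mu A2) <= s - r.
  have mrs : mu `[r, s[ = (s - r)%:E.
    move: rs; rewrite lebesgue_measure_itv/= lte_fin le_eqVlt.
    by case/predU1P => [->|rs]; rewrite ?ltxx ?subrr// rs.
  rewrite -lee_fin fineK; last first.
    rewrite ge0_fin_numE//; apply: (@le_lt_trans _ _ (mu `[r, s[)).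
      by rewrite le_measure ?inE//; exact: subIsetr.
    by rewrite mrs ltry.
  by rewrite -mrs le_measure ?inE//; exact: subIsetr.
have A1A : `]0, r[ `<=` `]0, l[.
  by apply: subset_itvl; rewrite bnd_simp (le_trans rs).
have A2A : A2 `<=` `]0, l[.
  apply: subset_trans (@subIsetl _ _ _) _.
  by apply: subset_itvl; rewrite bnd_simp.
have A12 : `]0, r[ `&` A2 = set0.
  apply/seteqP; split => // x [/= + [_ /=]]; rewrite !in_itv/=.
  by move=> /andP[_ xr] /andP[/le_lt_trans/(_ xr)]; rewrite ltxx.
have AF : vL2on mu (`]0, r[ `|` A2) F.
  apply: vL2onW sF => x /=; rewrite !in_itv/= => /andP[x0 xs].
  have [xr|rx] := ltP x r; first by left; rewrite x0.
  by right; split; rewrite /= in_itv/= ?x0 ?rx xs.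
have lE := lebesgue_measure_oo0 (ltW l0).
have := form_split_ge (mu := mu) C0 (measurable_oo0 l)
  (lebesgue_measure_oo0_lty l) kC aC kS a_coercive e0 (measurable_oo0 r) mA2
  A1A A2A A12 AF.
rewrite /= lE; apply: le_trans; rewrite lerB// lerDl mulr_ge0 ?vip_ge0//.
rewrite subr_ge0 (le_trans _ small)//.
by rewrite ler_wpM2l// mulr_ge0// addr_ge0// invr_ge0 ltW.
Qed.

Hypothesis inv : forall r, 0 < r <= l -> exists2 K, 0 <= K &
  forall F, vL2on mu `]0, r[ F ->
  N F F <= K * N (vcut `]0, r[ (opS mu a k F)) (vcut `]0, r[ (opS mu a k F)).

(** The constant in [inv] may vary with r without any uniformity. It is therefore invoked at the
    supremum itself, after nonnegativity has been established there. *)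
Lemma form_ge0 F : vL2on mu `]0, l[ F -> 0 <= Q F F.
Proof.
pose E := [set r : R | 0 <= r <= l /\
  forall F, vL2on mu `]0, r[ F -> 0 <= Q F F].
have E0 : E 0.
  split; first by rewrite lexx ltW.
  by move=> G G0; rewrite /form vipC vip_oo00.
have Eub : has_ubound E by exists l => r [/andP[]].
have supE : has_sup E by split; first by exists 0.
set s := sup E.
have s0 : 0 <= s by exact: ub_le_sup.
have sl : s <= l by apply: ge_sup; [exists 0|move=> r [/andP[]]].
(* The 1 added to the denominator of the witness covers the case c = 0. *)
have small e b : 0 < e -> 0 < b -> exists2 h, 0 < h & c * (1 + e^-1) * h <= b.
  move=> e0 b0; have q0 : 0 <= c * (1 + e^-1).
    by rewrite mulr_ge0// addr_ge0// invr_ge0 ltW.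
  exists (b / (c * (1 + e^-1) + 1)); first by rewrite divr_gt0// ltr_wpDl.
  by rewrite mulrA ler_pdivrMr ?ltr_wpDl// mulrC ler_wpM2l ?(ltW b0)// lerDl.
have cl1 : 0 < c * l + 1 by rewrite ltr_wpDl// mulr_ge0// ltW.
have Es : E s.
  split; first by rewrite s0.
  move=> G sG; apply/ler_addgt0Pl => eta eta0.
  (* Since cutting does not increase the norm, this weight makes the loss c e l |G1|^2 at most
     [eta]. It may depend on [G] because the length [r] below the supremum is chosen afterwards. *)
  pose e := eta / (c * l + 1) / (N G G + 1).
  have vG1 : 0 < N G G + 1 by rewrite ltr_wpDl ?vip_ge0.
  have e0 : 0 < e by rewrite !divr_gt0.
  have [h h0 hsmall] := small _ _ e0 alpha0.
  have [r [/andP[r0 rl] rpos] shr] := sup_adherent h0 supE.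
  have rs : r <= s by apply: ub_le_sup => //; split=> //; rewrite r0.
  have := form_cut_ge r0 rs sl e0 _ sG.
  set G1 := vcut _ _; set V := N G1 G1.
  have -> : c * (1 + e^-1) * (s - r) <= alpha.
    apply: le_trans hsmall; rewrite ler_wpM2l//.
      by rewrite mulr_ge0// addr_ge0// invr_ge0 ltW.
    by rewrite -/s in shr; lra.
  move=> /(_ isT); have : 0 <= Q G1 G1.
    apply: rpos; have := @vL2on_cut _ _ _ mu _ _ `]0, r[%classic _ _ sG.
    by move=> /(_ _)/(vL2onW (@subIsetr _ _ _)); apply.
  have : c * e * l * V <= eta.
    have -> : c * e * l * V = eta * ((c * l) / (c * l + 1) * (V / (N G G + 1))).
      by rewrite /e; field; rewrite !gt_eqF.
    rewrite ler_piMr ?(ltW eta0)// mulr_ile1//.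
    - by rewrite divr_ge0 ?mulr_ge0 ?(ltW l0) ?(ltW cl1).
    - by rewrite divr_ge0 ?vip_ge0// ltW.
    - by rewrite ler_pdivrMr// mul1r lerDl.
    - rewrite ler_pdivrMr// mul1r (@le_trans _ _ (N G G)) ?lerDl//.
      exact: vip_cut_le sG.
  by move: (Q G1 G1) (Q G G) (c * e * l * V) => x y z; lra.
suff -> : l = s by case: Es => _; apply.
apply/eqP; rewrite eq_le sl andbT leNgt; apply/negP => ltsl.
have [delta delta0 sdelta] : exists2 delta, 0 < delta &
    forall G : P -> measurableTypeR R -> R, vL2on mu `]0, s[ G ->
    delta * N G G <= Q G G.
  (* For s = 0 the invertibility bound says nothing, but the space is trivial and any constant will
     do. *)
  have [s_eq0|s_neq0] := eqVneq s 0.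
    exists 1 => // G; rewrite s_eq0 => G0.
    by rewrite mul1r /form [leRHS]vipC !vip_oo00.
  have s_gt0 : 0 < s by rewrite lt_def s_neq0.
  have [K K0 GK] : exists2 K, 0 <= K & forall F, vL2on mu `]0, s[ F ->
    N F F <= K * N (vcut `]0, s[ (opS mu a k F)) (vcut `]0, s[ (opS mu a k F)).
    by apply: inv; rewrite s_gt0.
  apply: (strictly_positive_form (mu := mu) C0 _ _ kC aC kS _ _ K0 Es.2 GK)
    => //.
    exact: lebesgue_measure_oo0_lty.
  by apply: subset_itvl; rewrite bnd_simp.
(* With this weight the loss on (0, s) is at most [delta] times the squared norm, which strict
   positivity at [s] pays for; no dependence on the function is left, so a whole length [t] beyond
   [s] is reached. *)
pose e := delta / (c * l + 1).
have e0 : 0 < e by rewrite divr_gt0.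
have [h h0 hsmall] := small _ _ e0 alpha0.
pose t := Num.min l (s + h).
have st : s < t by rewrite lt_min ltsl ltrDl.
have tl : t <= l by rewrite ge_min lexx.
suff : E t by move=> /(ub_le_sup Eub); rewrite leNgt st.
split; first by rewrite tl (le_trans s0 (ltW st)).
move=> G tG; have := form_cut_ge s0 (ltW st) tl e0 _ tG.
set G1 := vcut _ _; set V := N G1 G1.
have -> : c * (1 + e^-1) * (t - s) <= alpha.
  apply: le_trans hsmall; rewrite ler_wpM2l//.
    by rewrite mulr_ge0// addr_ge0// invr_ge0 ltW.
  by rewrite lerBlDl ge_min lexx orbT.
move=> /(_ isT); apply: le_trans; rewrite subr_ge0.
apply: (@le_trans _ _ (delta * V)); last first.
  apply: sdelta; have := @vL2on_cut _ _ _ mu _ _ `]0, s[%classic _ _ tG.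
  by move=> /(_ _)/(vL2onW (@subIsetr _ _ _)); apply.
rewrite ler_wpM2r ?vip_ge0// /e.
have -> : c * (delta / (c * l + 1)) * l = delta * ((c * l) / (c * l + 1)).
  by field; rewrite gt_eqF.
by rewrite ler_piMr ?(ltW delta0)// ler_pdivrMr// mul1r lerDl.
Qed.

Lemma form_strictly_positive r : 0 < r <= l -> exists2 delta, 0 < delta &
  forall F, vL2on mu `]0, r[ F -> delta * N F F <= Q F F.
Proof.
move=> /andP[r0 rl]; have [K K0 FK] : exists2 K, 0 <= K & forall F,
    vL2on mu `]0, r[ F -> N F F <=
      K * N (vcut `]0, r[ (opS mu a k F)) (vcut `]0, r[ (opS mu a k F)).
  by apply: inv; rewrite r0.
have rAl : `]0, r[ `<=` `]0, l[ by apply: subset_itvl; rewrite bnd_simp.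
apply: (strictly_positive_form (mu := mu) C0 _ _ kC aC kS _ rAl K0 _ FK) => //.
  exact: lebesgue_measure_oo0_lty.
by move=> F rF; apply: form_ge0; exact: vL2onW rF.
Qed.

End Continuation.

(** * Measurability of the kernel *)

Section RealParts.
Context {R : realType}.
Implicit Types z w : R[i].

Definition part (b : bool) z : R := if b then complex.Im z else complex.Re z.

Lemma partB b z w : part b (z - w) = part b z - part b w.
Proof. by case: b z w => -[a c] [a' c']. Qed.

Lemma partD b z w : part b (z + w) = part b z + part b w.
Proof. by case: b z w => -[a c] [a' c']. Qed.

Lemma part0 b : part b 0 = 0.
Proof. by case: b. Qed.

Lemma part_sum b (I : Type) (s : seq I) (f : I -> R[i]) :
  part b (\sum_(i <- s) f i) = \sum_(i <- s) part b (f i).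
Proof.
by elim/big_rec2: _ => [|i _ y _ <-]; rewrite ?part0 ?partD.
Qed.

Lemma part_realM b (a : R) z : part b (a%:C * z) = a * part b z.
Proof. by case: b z => -[x y] /=; ring. Qed.

Lemma normr_part b z : `|part b z|%:C <= `|z|.
Proof.
case: b; rewrite /part; last exact: normc_ge_Re.
case: z => x y /=; rewrite normc_def /= lecR -sqrtr_sqr.
rewrite ler_sqrt ?lerDr ?sqr_ge0//.
by rewrite addr_ge0 ?sqr_ge0.
Qed.

Lemma cvg_part (T : Type) (F : set_system T) (FF : Filter F) b
    (f : T -> (R[i] : numFieldType)) (z : (R[i] : numFieldType)) :
  f @ F --> z -> (fun x => part b (f x)) @ F --> part b z.
Proof.
move=> fz; apply/cvgrPdist_lt => e e0.
have eC : 0 < e%:C by rewrite ltcR.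
have zF : \forall x \near F, `|z - f x| < e%:C by exact: cvgr_dist_lt.
apply: filterS zF => x zx; rewrite -partB -ltcR.
exact: le_lt_trans (normr_part b (z - f x)) zx.
Qed.

End RealParts.

(** * Measurability of derivatives relative to an interval *)

Section MeasurableDerivative.
Context {R : realType}.

(** The derivative need not be continuous, but it is the pointwise limit of the quotients with
    increment 1/(n+1). These are measurable because [psi], being differentiable, is continuous on
    the open interval; extending it by zero gives meaning to the finitely many quotients that leave
    the interval. *)
Lemma measurable_within_derivative (l : R) (psi D : R -> R) :
  (forall x, 0 < x < l ->
    (y - x)^-1 * (psi y - psi x) @[y --> within `[0, l] x^'] --> D x) ->
  measurable_fun `]0, l[ D.
Proof.
move=> psiD.
have near_oo x : 0 < x < l -> \forall y \near x, 0 < y < l.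
  move=> xl; have xI : x \in `]0, l[ by rewrite in_itv.
  by have := near_in_itvoo xI; apply: filterS => y; rewrite in_itv.
have psiD' x : 0 < x < l ->
    (y - x)^-1 * (psi y - psi x) @[y --> x^'] --> D x.
  (* At an interior point the condition of staying in [0, l] holds eventually, so the relative limit
     is the ordinary one. *)
  move=> xl; apply: cvg_trans (psiD x xl); apply: cvg_app => Q /= AQ.
  have xI : \forall y \near x^', 0 < y < l by apply: cvg_within; exact: near_oo.
  have AQ' : \forall y \near x^', `[0, l]%classic y -> Q y by [].
  apply: filterS2 xI AQ' => y /andP[y0 yl]; apply.
  by rewrite /= in_itv/= !ltW.
have psi_cont : {in `]0, l[%classic, continuous psi}.
  move=> x; rewrite inE/= in_itv/= => xl; apply/continuous_withinNx.
  have xx : y - x @[y --> x^'] --> (0 : R).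
    rewrite -[X in _ --> X](subrr x); apply: cvgB; last exact: cvg_cst.
    exact: cvg_within.
  have p0 : (y - x) * ((y - x)^-1 * (psi y - psi x)) + psi x @[y --> x^'] -->
      0 * D x + psi x.
    by apply: cvgD; [exact: cvgM (psiD' x xl)|exact: cvg_cst].
  rewrite mul0r add0r in p0; apply: cvg_trans p0.
  apply: near_eq_cvg; near=> y => /=.
  rewrite mulrA divff ?mul1r ?subrK// subr_eq0.
  by near: y; exact: nbhs_dnbhs_neq.
pose psi0 := psi \_ `]0, l[.
have mpsi0 : measurable_fun setT psi0.
  apply/(measurable_restrictT _ _).1 => //.
  exact: open_continuous_measurable_fun.
pose q (n : nat) x := n.+1%:R * (psi0 (x + n.+1%:R^-1) - psi0 x).
apply: (@measurable_fun_cvg _ _ _ _ q).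
  move=> n; apply: measurable_funM => //; apply: measurable_funB.
    by apply: measurableT_comp => //; exact: measurable_funD.
  exact: measurable_funS mpsi0.
move=> x /=; rewrite in_itv/= => xl.
have xn : x + n.+1%:R^-1 @[n --> \oo] --> x.
  rewrite -[X in _ --> X]addr0; apply: cvgD; first exact: cvg_cst.
  exact: cvg_harmonic.
have xn' : x + n.+1%:R^-1 @[n --> \oo] --> x^'.
  move=> Q /= Qx; have Qx' : \forall y \near x, y != x -> Q y by [].
  have xnQ : \forall n \near \oo, x + n.+1%:R^-1 != x -> Q (x + n.+1%:R^-1).
    exact: (xn _ Qx').
  apply: filterS xnQ => n; apply.
  by rewrite -subr_eq0 addrAC subrr add0r invr_eq0 pnatr_eq0.
have := cvg_comp _ _ xn' (psiD' x xl).
apply: cvg_trans; apply: near_eq_cvg; near=> n => /=.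
have xnl : 0 < x + n.+1%:R^-1 < l by near: n; exact: (xn _ (near_oo x xl)).
rewrite /q /psi0 !patchE !mem_set /= ?in_itv//=.
by rewrite addrAC subrr add0r invrK.
Unshelve. all: by end_near.
Qed.

End MeasurableDerivative.

Lemma measurable_derive_within (R : realType) (l : R) m n
    (F : R -> 'M[R[i]]_(m, n)) b i j :
  (forall x, `[0, l]%classic x -> derivable_within `[0, l] F x) ->
  measurable_fun `]0, l[ (fun x => part b (derive_within `[0, l] F x i j)).
Proof.
move=> dF.
apply: (@measurable_within_derivative _ l (fun x => part b (F x i j))) => //.
move=> x /andP[x0 xl].
have xA : `[0, l]%classic x by rewrite /= in_itv/= !ltW.
have dFij : (fun y => diff_quotient F x y i j : (R[i] : numFieldType))
    @ within `[0, l] x^' -->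
    (derive_within `[0, l] F x i j : (R[i] : numFieldType)).
  have dFx : diff_quotient F x @ within `[0, l] x^' -->
      (derive_within `[0, l] F x : 'M[R[i] : numFieldType]_(m, n)) := dF x xA.
  exact: cvg_comp dFx (@coord_continuous _ _ _ i j _).
have := @cvg_part _ _ _ _ b _ _ dFij.
rewrite (_ : (fun y => _) =
  fun y => (y - x)^-1 * (part b (F y i j) - part b (F x i j))).
  by apply; exact: within_filter.
by apply/funext => y; rewrite !mxE part_realM partB.
Qed.

(** * The algebra of bounded measurable complex functions *)

Section BoundedMeasurable.
Context {R : realType} d {T : measurableType d}.
Implicit Types f g : T -> R[i].

Definition bmeasurable f :=
  (forall b, measurable_fun setT (fun x => part b (f x))) /\
  exists M : R, forall b x, `|part b (f x)| <= M.

Lemma bmeasurable_cst z : bmeasurable (fun=> z).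
Proof.
split=> //; exists (`|part true z| + `|part false z|).
by case=> _; rewrite ?lerDl ?lerDr.
Qed.

Lemma bmeasurableD f g : bmeasurable f -> bmeasurable g ->
  bmeasurable (fun x => f x + g x).
Proof.
move=> [mf [M fM]] [mg [N gN]]; split.
  by move=> b; under eq_fun do rewrite partD; exact: measurable_funD.
by exists (M + N) => b x; rewrite partD (le_trans (ler_normD _ _))// lerD.
Qed.

Lemma bmeasurable_sum (I : Type) (s : seq I) (f : I -> T -> R[i]) :
  (forall i, bmeasurable (f i)) -> bmeasurable (fun x => \sum_(i <- s) f i x).
Proof.
move=> mf; elim: s => [|i s IHs].
  by under eq_fun do rewrite big_nil; exact: bmeasurable_cst.
by under eq_fun do rewrite big_cons; exact: bmeasurableD.
Qed.

Lemma part_mul b z w : part b (z * w) = if b then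
  part false z * part true w + part true z * part false w else
  part false z * part false w - part true z * part true w :> R.
Proof. by case: b z w => -[x y] [x' y']. Qed.

Lemma bmeasurableM f g : bmeasurable f -> bmeasurable g ->
  bmeasurable (fun x => f x * g x).
Proof.
move=> [mf [M fM]] [mg [N gN]]; split.
  move=> b; under eq_fun do rewrite part_mul; case: b.
    by apply: measurable_funD; exact: measurable_funM.
  by apply: measurable_funB; exact: measurable_funM.
have MN b c x : `|part b (f x) * part c (g x)| <= M * N.
  by rewrite normrM ler_pM.
exists (M * N + M * N) => b x; rewrite part_mul; case: b.
  by rewrite (le_trans (ler_normD _ _))// lerD.
by rewrite (le_trans (ler_normB _ _))// lerD.
Qed.

Lemma part_conj b z : part b (Num.conj z) = (-1) ^+ b * part b z :> R.
Proof. by case: b z => -[x y] /=; rewrite ?expr0 ?expr1 ?mul1r ?mulN1r. Qed.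

Lemma bmeasurable_conj f :
  bmeasurable f -> bmeasurable (fun x => Num.conj (f x)).
Proof.
move=> [mf [M fM]]; split.
  move=> b; under eq_fun do rewrite part_conj; exact: measurable_funM.
by exists M => b x; rewrite part_conj normrMsign.
Qed.

End BoundedMeasurable.

Lemma bmeasurable_comp (R : realType) d d' (T : measurableType d)
    (T' : measurableType d') (f : T -> R[i]) (h : T' -> T) :
  measurable_fun setT h -> bmeasurable f -> bmeasurable (fun x => f (h x)).
Proof.
move=> mh [mf [M fM]]; split; last by exists M.
by move=> b; exact: measurableT_comp (mf b) mh.
Qed.

Lemma bmeasurable_indic (R : realType) d (T : measurableType d) (A : set T) :
  measurable A -> bmeasurable (fun x => (\1_A x)%:C : R[i]).
Proof.
move=> mA; split.
  by case=> /=; [exact: measurable_cst|exact: measurable_indic].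
exists 1; case=> x; rewrite /= ?normr0 ?ler01// indicE.
by rewrite normr_nat lern1 leq_b1.
Qed.

Lemma part_Cintegral (R : realType) b (D : set R) (f : R -> R[i]) :
  part b (Cintegral D f) = \int[lebesgue_measure]_(x in D) part b (f x).
Proof. by case: b. Qed.

(** * The kernel as a bounded measurable Hermitian function *)

Section Kernel.
Context {R : realType} {m1 m2 : nat}.
Variables (l : R) (Phi1 : R -> 'M[R[i]]_(m2, m1)).
Hypothesis l0 : 0 < l.
Hypothesis hPhi1 : boundedly_differentiable `[0, l] Phi1.
Notation mu := (@lebesgue_measure R).
Notation T := (measurableTypeR R).

(** For points of (0, l) the kernel evaluates the derivative, off the diagonal, only at arguments
    strictly between 0 and l; cutting at the open interval thus loses nothing and avoids the
    endpoints, where the derivative is one-sided. *)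
Definition cut_derivative i j (x : T) : R[i] :=
  if 0 < x < l then derive_within `[0, l] Phi1 x i j else 0.

Lemma bmeasurable_cut_derivative i j : bmeasurable (cut_derivative i j).
Proof.
have [dPhi [K PhiK]] := hPhi1; split.
  move=> b; have mD := measurable_derive_within b i j dPhi.
  rewrite (_ : (fun _ => _) =
    (fun x => part b (derive_within `[0, l] Phi1 x i j)) \_ `]0, l[).
    by apply/(measurable_restrictT _ _).1.
  apply/funext => x; rewrite patchE mem_setE/= in_itv/= /cut_derivative.
  by case: ifP; rewrite ?part0.
exists K => b x; rewrite /cut_derivative; case: ifPn => [/andP[x0 xl]|_].
  rewrite -lecR (le_trans (normr_part _ _))//.
  by apply: PhiK; rewrite /= in_itv/= !ltW.
(* The bound [K] is nonnegative because it dominates a modulus at the point [l]. *)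
have lA : `[0, l]%classic l by rewrite /= in_itv/= lexx ltW.
by rewrite part0 normr0 -lecR; exact: le_trans (normr_ge0 _) (PhiK l lA i j).
Qed.

(* As [cut_derivative] vanishes outside [0, l], the restriction to
   [zeta < min(x, t)] and the case distinction of [kernel_s] disappear. *)
Definition integrand i j (z : T * T) (zeta : T) : R[i] :=
  (\1_(`]0, l[%classic) zeta)%:C * \sum_k
    cut_derivative i k (z.1 - zeta) * 
    Num.conj (cut_derivative j k (z.2 - zeta)).

Definition cut_kernel i j (z : T * T) : R[i] :=
  Cintegral setT (integrand i j z) +
  \sum_k (cut_derivative i k (z.1 - z.2) * Num.conj (Phi1 0 j k) +
          Phi1 0 i k * Num.conj (cut_derivative j k (z.2 - z.1))).

Lemma cut_derivative_eq0 i j x : x <= 0 -> cut_derivative i j x = 0.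
Proof. by move=> x0; rewrite /cut_derivative ltNge x0. Qed.

Lemma bmeasurable_cut_derivative_comp d (X : measurableType d) (h : X -> R)
    i j :
  measurable_fun setT h -> bmeasurable (fun x => cut_derivative i j (h x)).
Proof.
move=> mh; apply: (@bmeasurable_comp _ _ _ T X _ h) => //.
exact: bmeasurable_cut_derivative.
Qed.

Lemma bmeasurable_integrand i j :
  bmeasurable (fun z : (T * T) * T => integrand i j z.1 z.2).
Proof.
apply: bmeasurableM.
  apply: (@bmeasurable_comp _ _ _ T _
    (fun x => (\1_(`]0, l[%classic) x)%:C) _ measurable_snd).
  by apply: (@bmeasurable_indic _ _ T); exact: measurable_oo0.
apply: bmeasurable_sum => k; apply: bmeasurableM.
  apply: bmeasurable_cut_derivative_comp; apply: measurable_funB.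
    exact: measurableT_comp measurable_fst measurable_fst.
  exact: measurable_snd.
apply: bmeasurable_conj.
apply: bmeasurable_cut_derivative_comp; apply: measurable_funB.
  exact: measurableT_comp measurable_snd measurable_fst.
exact: measurable_snd.
Qed.

Lemma integrand_bound i j : exists2 M, 0 <= M & forall b z zeta,
  `|part b (integrand i j z zeta)| <= M * \1_(`]0, l[%classic) zeta.
Proof.
have [_ [M wM]] := bmeasurable_integrand i j.
have M0 : 0 <= M := le_trans (normr_ge0 _) (wM true ((0, 0), 0)).
exists M => // b z zeta.
have := wM b (z, zeta); rewrite /integrand/= indicE.
by case: (_ \in _) => /=; rewrite ?mulr1// mul0r part0 normr0 mulr0.
Qed.

Lemma itg_integrand b i j z :
  itg mu (fun zeta => part b (integrand i j z zeta)).
Proof.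
have [M M0 wM] := integrand_bound i j.
have iM := itg_cst_on M (measurable_oo0 l) (lebesgue_measure_oo0_lty l).
apply: (dominated_itg _ iM (wM b z)).
have [mw _] := bmeasurable_integrand i j.
exact: measurableT_comp (mw b) (measurable_pair1 z).
Qed.

Lemma bmeasurable_cut_kernel i j : bmeasurable (cut_kernel i j).
Proof.
apply: bmeasurableD; last first.
  apply: bmeasurable_sum => k; apply: bmeasurableD; apply: bmeasurableM.
  - apply: bmeasurable_cut_derivative_comp; apply: measurable_funB.
      exact: measurable_fst.
    exact: measurable_snd.
  - exact: bmeasurable_cst.
  - exact: bmeasurable_cst.
  - apply/bmeasurable_conj/bmeasurable_cut_derivative_comp.
    apply: measurable_funB.
      exact: measurable_snd.
    exact: measurable_fst.
have [mw _] := bmeasurable_integrand i j; split.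
  move=> b; under eq_fun do rewrite part_Cintegral.
  exact: (@measurable_Rintegral _ _ _ _ _ mu
    (fun z => part b (integrand i j z.1 z.2)) (mw b)).
have [M M0 wM] := integrand_bound i j.
exists (\int[mu]_zeta (M * \1_(`]0, l[%classic) zeta)) => b z.
rewrite part_Cintegral.
apply: (le_trans (le_normr_Rintegral measurableT (itg_integrand b i j z))).
apply: le_Rintegral => //.
- exact: itg_norm (itg_integrand b i j z).
- exact: itg_cst_on (measurable_oo0 l) (lebesgue_measure_oo0_lty l).
Qed.

Lemma part_inj (z w : R[i]) : (forall b, part b z = part b w) -> z = w.
Proof.
move=> zw; have := zw true; have := zw false.
by case: z w {zw} => [x y] [x' y'] /= -> ->.
Qed.

Lemma integrandC i j x y zeta :
  integrand j i (y, x) zeta = Num.conj (integrand i j (x, y) zeta).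
Proof.
rewrite /integrand rmorphM rmorph_sum/=; congr (_ * _).
  by apply: part_inj => b; rewrite part_conj; case: b; rewrite /= ?mul1r ?mulr0.
by apply: eq_bigr => k _; rewrite rmorphM/= conjCK mulrC.
Qed.

Lemma cut_kernelC i j x y :
  cut_kernel j i (y, x) = Num.conj (cut_kernel i j (x, y)).
Proof.
rewrite /cut_kernel rmorphD rmorph_sum/=; congr (_ + _); last first.
  apply: eq_bigr => k _; rewrite rmorphD !rmorphM/= !conjCK addrC.
  by congr (_ + _); rewrite mulrC.
apply: part_inj => b; rewrite part_conj !part_Cintegral.
rewrite -RintegralZl//; last exact: itg_integrand.
by apply: eq_Rintegral => zeta _; rewrite integrandC part_conj.
Qed.

(** Beyond min(x, t) one factor of the integrand has a nonpositive argument and vanishes. Of the two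
    boundary terms exactly one can survive off the diagonal, and on it both vanish, in agreement
    with the default value 0. *)
Lemma kernel_sE x t i j : 0 < x < l -> 0 < t < l ->
  kernel_s l Phi1 x t i j = cut_kernel i j (x, t).
Proof.
move=> /andP[x0 xl] /andP[t0 tl]; rewrite /kernel_s /cut_kernel !mxE.
congr (_ + _).
  apply: part_inj => b; rewrite !part_Cintegral Rintegral_mkcond.
  apply: eq_Rintegral => zeta _; rewrite patchE mem_setE/= in_itv/= lt_min.
  rewrite /integrand indicE mem_setE/= in_itv/=.
  have [zeta0/=|zeta0/=] := ltP 0 zeta; last by rewrite mul0r part0.
  have [zx/=|xz/=] := ltP zeta x; last first.
    rewrite big1 ?mulr0 ?part0// => k _.
    by rewrite cut_derivative_eq0 ?mul0r ?subr_le0.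
  have [zt/=|tz/=] := ltP zeta t; last first.
    rewrite big1 ?mulr0 ?part0// => k _.
    by rewrite (cut_derivative_eq0 j k) ?rmorph0 ?mulr0 ?subr_le0.
  rewrite (lt_trans zx xl) mul1r !mxE; congr part; apply: eq_bigr => k _.
  rewrite !mxE /cut_derivative !subr_gt0 zx zt.
  by rewrite !ltrBlDr (lt_trans xl) ?(lt_trans tl)// ltrDl.
have [tx|xt] := ltP t x.
  rewrite !mxE; apply: eq_bigr => k _; rewrite !mxE.
  rewrite (cut_derivative_eq0 j k) ?subr_le0 ?(ltW tx)// rmorph0 mulr0 addr0.
  by rewrite /cut_derivative subr_gt0 tx ltrBlDr (lt_trans xl) ?ltrDl.
have [tx|tx] := ltP x t.
  rewrite !mxE; apply: eq_bigr => k _; rewrite !mxE.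
  rewrite (cut_derivative_eq0 i k) ?subr_le0 ?(ltW tx)// mul0r add0r.
  by rewrite /cut_derivative subr_gt0 tx ltrBlDr (lt_trans tl) ?ltrDl.
rewrite mxE big1// => k _.
rewrite (cut_derivative_eq0 i k) ?subr_le0//.
by rewrite (cut_derivative_eq0 j k) ?subr_le0// rmorph0 mul0r mulr0 addr0.
Qed.

End Kernel.

(** * Passage from complex to real *)

Section RealMatrix.
Context {R : realType}.
Implicit Types z w : R[i].

(* The entries of the real 2x2 matrix of multiplication by [z]. *)
Definition mulpart (b c : bool) z : R := (-1) ^+ (~~ b && c) * part (b (+) c) z.

Lemma part_mulE b z w : part b (z * w) = \sum_c mulpart b c z * part c w.
Proof.
rewrite big_bool /mulpart; case: b z w => -[x y] [x' y'] /=;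
  by rewrite ?expr0 ?expr1; ring.
Qed.

(** Conjugation becomes transposition of the 2x2 block, which is how Hermitian complex data turn
    into symmetric real data. *)
Lemma mulpart_conj b c z : mulpart b c (Num.conj z) = mulpart c b z.
Proof.
rewrite /mulpart part_conj; case: b c z => -[] [x y] /=;
  by rewrite ?expr0 ?expr1; ring.
Qed.

Lemma sum_partE m (f : 'I_m * bool -> R) :
  \sum_p f p = \sum_i (f (i, true) + f (i, false)).
Proof.
rewrite (eq_bigr (fun p => f (p.1, p.2))); last by move=> [].
rewrite -(pair_bigA _ (fun i b => f (i, b))).
by apply: eq_bigr => i _; rewrite big_bool.
Qed.

Lemma part_mulmx n m (M : 'M[R[i]]_(n, m)) (v : 'cV[R[i]]_m) b i :
  part b ((M *m v) i 0) =
  \sum_(q : 'I_m * bool) mulpart b q.2 (M i q.1) * part q.2 (v q.1 0).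
Proof.
rewrite mxE part_sum sum_partE; apply: eq_bigr => j _.
by rewrite part_mulE big_bool.
Qed.

Lemma Re_dotmx m (v w : 'cV[R[i]]_m) :
  part false ((v^t* *m w) 0 0) =
  \sum_(p : 'I_m * bool) part p.2 (w p.1 0) * part p.2 (v p.1 0).
Proof.
rewrite mxE part_sum sum_partE; apply: eq_bigr => j _.
by rewrite !mxE; case: (v j 0) (w j 0) => [x y] [x' y'] /=; ring.
Qed.

Lemma Im_dotmx m (v w : 'cV[R[i]]_m) :
  part true ((v^t* *m w) 0 0) =
  \sum_i (part true (w i 0) * part false (v i 0) -
          part false (w i 0) * part true (v i 0)).
Proof.
rewrite mxE part_sum; apply: eq_bigr => j _.
by rewrite !mxE; case: (v j 0) (w j 0) => [x y] [x' y'] /=; ring.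
Qed.

Lemma sqnormvE m (v : 'cV[R[i]]_m) :
  sqnormv v = \sum_(p : 'I_m * bool) part p.2 (v p.1 0) ^+ 2.
Proof.
rewrite sum_partE; apply: eq_bigr => i _; case: (v i 0) => x y /=.
by rewrite sqr_sqrtr ?addr_ge0 ?sqr_ge0// addrC.
Qed.

Definition cvec m (v : 'I_m * bool -> R) : 'cV[R[i]]_m :=
  \col_i (v (i, false) +i* v (i, true)).

Lemma part_cvec m (v : 'I_m * bool -> R) b i : part b (cvec v i 0) = v (i, b).
Proof. by rewrite mxE; case: b. Qed.

(** The finite-dimensional counterpart of the argument for operators: a positive definite matrix is
    invertible, and the inverse bound upgrades positivity to coercivity, without compactness of the
    sphere or eigenvalues. *)
Lemma posdefmx_coercive m (A : 'M[R[i]]_m) :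
  posdefmx A -> (forall i j, A j i = Num.conj (A i j)) ->
  exists2 alpha, 0 < alpha & forall v : 'I_m * bool -> R,
    alpha * \sum_p v p ^+ 2 <=
    \sum_p \sum_q mulpart p.2 q.2 (A p.1 q.1) * (v q * v p).
Proof.
move=> posA hermA; pose a (p q : 'I_m * bool) := mulpart p.2 q.2 (A p.1 q.1).
have aC p q : a p q = a q p by rewrite /a hermA mulpart_conj.
pose N (v : 'I_m * bool -> R) := \sum_p v p ^+ 2.
pose B (v w : 'I_m * bool -> R) := \sum_p \sum_q a p q * (v q * w p).
pose Am (v : 'I_m * bool -> R) p := \sum_q a p q * v q.
have AmE v p : part p.2 ((A *m cvec v) p.1 0) = Am v p.
  by rewrite part_mulmx; apply: eq_bigr => -[j c] _; rewrite part_cvec.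
have BE v : B v v = part false (((cvec v)^t* *m A *m cvec v) 0 0).
  rewrite -mulmxA Re_dotmx; apply: eq_bigr => -[i b] _.
  by rewrite AmE part_cvec mulr_suml; apply: eq_bigr => q _; rewrite mulrA.
have B_ge0 v : 0 <= B v v.
  rewrite BE; have [->|v0] := eqVneq (cvec v) 0.
    by rewrite mulmx0 mxE.
  by have := posA _ v0; rewrite ltcE => /andP[_ /ltW].
(* A row vector u with u A = 0 would give u A u^* = 0, against positivity at u^*. *)
have A_unit : A \in unitmx.
  rewrite -row_free_unit -kermx_eq0; apply/negPn/negP => /rowV0Pn[u + u0].
  move=> /sub_kermxP uA; have ut0 : u^t* != 0.
    apply: contra_neq u0 => /(congr1 (fun v => v^t*)) /=.
    by rewrite trmxCK trmx0 map_mx0.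
  by have := posA _ ut0; rewrite trmxCK uA mul0mx mxE ltxx.
have [K K0 NK] : exists2 K, 0 <= K & forall v, N v <= K * N (Am v).
  pose b (p q : 'I_m * bool) := mulpart p.2 q.2 (invmx A p.1 q.1).
  (* Each component of v = A^-1 (A v) is at most the l^1 norm of a row of the inverse times the
     Euclidean norm of A v. *)
  exists (\sum_p (\sum_q `|b p q|) ^+ 2).
    by apply: sumr_ge0 => p _; exact: sqr_ge0.
  move=> v; rewrite mulr_suml; apply: ler_sum => p _.
  have N0 : 0 <= N (Am v) by apply: sumr_ge0 => q _; exact: sqr_ge0.
  have vE : v p = \sum_q b p q * Am v q.
    transitivity (part p.2 ((invmx A *m (A *m cvec v)) p.1 0)).
      by rewrite mulKmx// part_cvec; case: (p).
    by rewrite part_mulmx; apply: eq_bigr => q _; rewrite AmE.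
  rewrite -(sqr_sqrtr N0) -exprMn -real_normK ?num_real// lerXn2r ?nnegrE//.
    by rewrite mulr_ge0 ?sqrtr_ge0// sumr_ge0.
  rewrite vE mulr_suml (le_trans (ler_norm_sum _ _ _))//; apply: ler_sum => q _.
  rewrite normrM ler_wpM2l// -sqrtr_sqr ler_sqrt//.
  by rewrite /N (bigD1 q)//= lerDl sumr_ge0// => i _; exact: sqr_ge0.
have [M M0 BM] : exists2 M, 0 < M & forall v, B v v <= M * N v.
  exists (\sum_p \sum_q `|a p q| + 1).
    by rewrite ltr_wpDl// sumr_ge0// => p _; exact: sumr_ge0.
  move=> v; have N0 : 0 <= N v by apply: sumr_ge0 => q _; exact: sqr_ge0.
  rewrite mulrDl mul1r -[leLHS]addr0 lerD//.
  rewrite mulr_suml; apply: ler_sum => p _; rewrite mulr_suml.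
  apply: ler_sum => q _; rewrite (le_trans (ler_norm _))// normrM ler_wpM2l//.
  have leN r : v r ^+ 2 <= N v.
    by rewrite /N (bigD1 r)//= lerDl sumr_ge0// => i _; exact: sqr_ge0.
  move: (leN p) (leN q); rewrite -!(real_normK (num_real (v _))) normrM.
  by have := sqr_ge0 (`|v p| - `|v q|); nra.
have BAm v : B v (Am v) = N (Am v).
  apply: eq_bigr => p _; rewrite expr2 {2}/Am mulr_suml.
  by apply: eq_bigr => q _; rewrite mulrA.
have BAm' v : B (Am v) v = N (Am v).
  rewrite -BAm /B exchange_big; apply: eq_bigr => p _; apply: eq_bigr => q _.
  by rewrite aC [Am v p * _]mulrC.
have KM0 : 0 < K * M + 1 by rewrite ltr_wpDl// mulr_ge0// ltW.
exists (K * M + 1)^-1; first by rewrite invr_gt0.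
move=> v; apply: (coercive_of_discrepancy M0 K0 (B_ge0 v) (BM (Am v)) (NK v)).
have := B_ge0 (fun p => v p - M^-1 * Am v p).
suff -> : B (fun p => v p - M^-1 * Am v p) (fun p => v p - M^-1 * Am v p) =
  M^-1 ^+ 2 * B (Am v) (Am v) - M^-1 * B (Am v) v - M^-1 * B v (Am v) + B v v.
  by rewrite BAm BAm'; move: (B _ _) (B _ _) (N _) => x y z; lra.
move: (Am v) => w.
rewrite /B !mulr_sumr -!sumrB -big_split; apply: eq_bigr => p _.
rewrite !mulr_sumr -!sumrB -big_split; apply: eq_bigr => q _.
by rewrite /=; ring.
Qed.

End RealMatrix.

(** * Complex L^2 functions as families of real ones *)

Section Realification.
Context {R : realType} {m : nat}.
Notation mu := (@lebesgue_measure R).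
Notation T := (measurableTypeR R).
Implicit Types (r : R) (f g : R -> 'cV[R[i]]_m).

Definition realify r f (p : 'I_m * bool) (x : T) : R :=
  if 0 < x < r then part p.2 (f x p.1 0) else 0.

Lemma realifyE r f p :
  realify r f p = (fun x => part p.2 (f x p.1 0)) \_ `]0, r[.
Proof.
by apply/funext => x; rewrite /realify patchE mem_setE/= in_itv.
Qed.

Lemma sqnormv_realify r f : (fun x => sqnormv (f x)) \_ `]0, r[ =
  (fun x => \sum_p realify r f p x ^+ 2).
Proof.
apply/funext => x; rewrite patchE mem_setE/= in_itv/= /realify sqnormvE.
case: ifP => // _; rewrite big1// => p _; exact: expr0n.
Qed.

Lemma measurable_part r f : inL2 r f ->
  forall p, measurable_fun `]0, r[ (fun x => part p.2 (f x p.1 0)).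
Proof. by move=> [mf _] [i []]; case: (mf i). Qed.

Lemma measurable_sqnormv r f : inL2 r f ->
  measurable_fun `]0, r[ (fun x => sqnormv (f x)).
Proof.
move=> rf.
rewrite (_ : (fun x => _) = fun x => \sum_p part p.2 (f x p.1 0) ^+ 2).
  by apply: measurable_sum => p; apply: measurable_funX; exact: measurable_part.
by apply/funext => x; rewrite sqnormvE.
Qed.

Lemma inL2P r f : inL2 r f <-> vL2on mu `]0, r[ (realify r f).
Proof.
split=> [rf p|Ff].
  have mp : measurable_fun setT (realify r f p).
    rewrite realifyE.
    exact: (measurable_restrictT _ (measurable_oo0 r)).1 (measurable_part rf p).
  split; last first.
    by move=> x; rewrite realifyE patchE => xr; rewrite memNset.
  split=> //.
  apply: (@dominated_itg _ _ _ _ _ (fun x => \sum_q realify r f q x ^+ 2)).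
  - exact: measurable_funX.
  - rewrite -sqnormv_realify /itg -restrict_EFin.
    apply: (integrable_mkcond _ (measurable_oo0 r)).1; apply/integrableP; split.
      by apply/measurable_EFinP; exact: measurable_sqnormv.
    have := rf.2; congr (_ < _)%E; apply: eq_integral => x _.
    rewrite /= ger0_norm// sqnormvE sumr_ge0// => q _; exact: sqr_ge0.
  - move=> x; rewrite ger0_norm ?sqr_ge0// (bigD1 p)//= lerDl.
    by apply: sumr_ge0 => q _; exact: sqr_ge0.
split.
  have mp p : measurable_fun `]0, r[ (fun x => part p.2 (f x p.1 0)).
    apply: (measurable_restrictT _ (measurable_oo0 r)).2; rewrite -realifyE.
    by case: (Ff p) => -[].
  by move=> i; split; [exact: (mp (i, false))|exact: (mp (i, true))].
have := integrable_lty measurableT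
  (itg_sum (index_enum _) (fun p => (Ff p).1.2)).
rewrite -sqnormv_realify; congr (_ < _)%E; rewrite [RHS]integral_mkcond.
by apply: eq_integral => x _; rewrite -restrict_EFin.
Qed.

Lemma L2norm_sqr r f : inL2 r f ->
  L2norm r f ^+ 2 = vip mu (realify r f) (realify r f).
Proof.
move=> /inL2P Ff; rewrite /L2norm sqr_sqrtr; last first.
  apply: Rintegral_ge0 => x _; rewrite sqnormvE sumr_ge0// => p _.
  exact: sqr_ge0.
rewrite Rintegral_mkcond sqnormv_realify Rintegral_sum; last first.
  by move=> p; case: (Ff p) => -[].
by apply: eq_bigr => p _; apply: eq_Rintegral => x _.
Qed.

Lemma L2norm_eqL2 r f g : inL2 r f -> inL2 r g -> eqL2 r f g ->
  L2norm r f = L2norm r g.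
Proof.
move=> rf rg fg; congr (Num.sqrt (fine _)); apply: ae_eq_integral => //.
- by apply/measurable_EFinP; exact: measurable_sqnormv.
- by apply/measurable_EFinP; exact: measurable_sqnormv.
- exact: (ae_eq_comp (fun v => (sqnormv v)%:E) fg).
Qed.

Lemma Re_L2dot r f g : inL2 r f -> inL2 r g ->
  part false (L2dot r f g) = vip mu (realify r f) (realify r g).
Proof.
move=> /inL2P Ff /inL2P Fg; rewrite part_Cintegral Rintegral_mkcond.
rewrite /vip /ip -Rintegral_sum; last first.
  by move=> p; exact: sqint_itgM (Ff p).1 (Fg p).1.
apply: eq_Rintegral => x _; rewrite patchE mem_setE/= in_itv/= /realify.
case: ifP => _; first exact: Re_dotmx.
by rewrite big1// => p _; rewrite mulr0.
Qed.

(* Multiplication by [i], in terms of real and imaginary parts. *)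
Definition rot (F : 'I_m * bool -> T -> R) p (x : T) : R :=
  if p.2 then F (p.1, false) x else - F (p.1, true) x.

Lemma rot_L2on (A : set T) F : vL2on mu A F -> vL2on mu A (rot F).
Proof.
move=> AF [i []]; first exact: AF.
by have := L2onZ (-1) (AF (i, true)); under eq_fun do rewrite mulN1r.
Qed.

(** The inner product is conjugate-linear in its second argument, so Im <f, g> = Re <f, i g>. *)
Lemma Im_L2dot r f g : inL2 r f -> inL2 r g ->
  part true (L2dot r f g) = vip mu (realify r f) (rot (realify r g)).
Proof.
move=> /inL2P Ff /inL2P Fg; rewrite part_Cintegral Rintegral_mkcond.
rewrite /vip /ip -Rintegral_sum; last first.
  by move=> p; exact: sqint_itgM (Ff p).1 (rot_L2on Fg p).1.
apply: eq_Rintegral => x _; rewrite patchE mem_setE/= in_itv/= /rot /realify.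
rewrite sum_partE; case: ifP => _.
  by apply: etrans (Im_dotmx _ _) _; apply: eq_bigr => i _; rewrite mulrN.
by rewrite big1// => i _; rewrite !mul0r addr0.
Qed.

Lemma vip_rot (A : set T) F G : vL2on mu A F -> vL2on mu A G ->
  vip mu (rot F) G = - vip mu F (rot G).
Proof.
move=> AF AG; rewrite /vip !sum_partE -sumrN; apply: eq_bigr => i _.
rewrite /rot/=.
rewrite (ipNl (AF (i, true)).1 (AG (i, false)).1).
by rewrite (ipNr (AF (i, false)).1 (AG (i, true)).1) opprD opprK addrC.
Qed.

End Realification.

(** * The real form of the operators S_r *)

Section RealOperator.
Context {R : realType} {m1 m2 : nat}.
Variables (l : R) (Phi1 : R -> 'M[R[i]]_(m2, m1)).
Hypothesis l0 : 0 < l.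
Hypothesis hPhi1 : boundedly_differentiable `[0, l] Phi1.
Notation mu := (@lebesgue_measure R).
Notation T := (measurableTypeR R).
Notation P := ('I_m2 * bool)%type.
Notation A0 := (1%:M - Phi1 0 *m (Phi1 0)^t*).

Definition real_coef (p q : P) : R := mulpart p.2 q.2 (A0 p.1 q.1).

(** [cut_kernel] can be nonzero outside the square, for instance through its dependence on x - t;
    the indicators confine it to (0, l) x (0, l), as [bkernel] demands. *)
Definition real_kernel (p q : P) (z : T * T) : R :=
  mulpart p.2 q.2 (cut_kernel l Phi1 p.1 q.1 z) *
  (\1_(`]0, l[%classic) z.1 * \1_(`]0, l[%classic) z.2).

Lemma A0_herm i j : A0 j i = Num.conj (A0 i j).
Proof.
rewrite !mxE rmorphB rmorph_nat rmorph_sum /= eq_sym; congr (_ - _).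
by apply: eq_bigr => k _; rewrite !mxE rmorphM/= conjCK mulrC.
Qed.

Lemma real_coefC p q : real_coef p q = real_coef q p.
Proof. by rewrite /real_coef (A0_herm q.1) mulpart_conj. Qed.

Lemma real_kernelC p q x y : real_kernel p q (x, y) = real_kernel q p (y, x).
Proof.
rewrite /real_kernel (cut_kernelC l0 hPhi1 q.1) mulpart_conj/=.
by congr (_ * _); exact: mulrC.
Qed.

Lemma real_kernel_bkernel : exists2 C, 0 <= C &
  forall p q, bkernel `]0, l[ C (real_kernel p q).
Proof.
have bk i j := bmeasurable_cut_kernel l0 hPhi1 i j.
have /choice[M hM] (ij : 'I_m2 * 'I_m2) : exists M : R, 0 <= M /\
    forall b z, `|part b (cut_kernel l Phi1 ij.1 ij.2 z)| <= M.
  have [_ [M hM]] := bk ij.1 ij.2; exists M; split=> //.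
  exact: le_trans (normr_ge0 _) (hM true (0, 0)).
have M0 ij : 0 <= M ij by case: (hM ij).
exists (\sum_ij M ij); first exact: sumr_ge0.
move=> p q; split.
  have mI (f : T * T -> T) : measurable_fun setT f ->
      measurable_fun setT (fun z => \1_(`]0, l[%classic) (f z) : R).
    move=> mf; apply: measurableT_comp mf.
    exact: measurable_indic (measurable_oo0 l).
  apply: measurable_funM.
    apply: (measurable_funM (measurable_cst _)); exact: (bk p.1 q.1).1.
  apply: measurable_funM; apply: mI; first exact: measurable_fst.
  exact: measurable_snd.
move=> x y; rewrite /real_kernel/= normrM -mulrA.
rewrite [X in _ * X]ger0_norm ?mulr_ge0// ler_wpM2r ?mulr_ge0//.
rewrite normrMsign; have [_ /(_ (p.2 (+) q.2) (x, y))] := hM (p.1, q.1).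
by move/le_trans; apply; rewrite (bigD1 (p.1, q.1))//= lerDl sumr_ge0.
Qed.

Notation SR := (opS mu real_coef real_kernel).

(** The kernel does not involve [r], and [realify r f] vanishes outside (0, r), so integrating over
    (0, r) or over everything gives the same; one operator thus serves all lengths. *)
Lemma realify_operator_S r f : r <= l -> inL2 r f ->
  realify r (operator_S l Phi1 r f) = vcut `]0, r[ (SR (realify r f)).
Proof.
move=> rl /inL2P rf; have [C C0 kC] := real_kernel_bkernel.
have rAl : `]0, r[ `<=` `]0, l[ by apply: subset_itvl; rewrite bnd_simp.
apply/funext => p; apply/funext => x.
rewrite vcutE mem_setE/= in_itv/= /realify.
case: ifP => // xr; have /andP[x0 xr'] := xr.
have xl : 0 < x < l by rewrite x0 (lt_le_trans xr').
rewrite /operator_S [X in part _ X]mxE [X in part _ (_ + X)]mxE partB.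
rewrite part_mulmx.
rewrite [X in _ - part _ X]mxE part_Cintegral Rintegral_mkcond /opS sumrB.
congr (_ - _).
  by apply: eq_bigr => q _; rewrite /realify xr.
rewrite -Rintegral_sum; last first.
  move=> q; have := bkernel_itg C0 (measurable_oo0 l)
    (lebesgue_measure_oo0_lty l) x (kC p q).
  by apply; exact: L2onW (rf q).
apply: eq_Rintegral => t _; rewrite patchE mem_setE/= in_itv/=.
case: ifP => tr; last first.
  by rewrite big1// => q _; rewrite mulr0.
have /andP[t0 tr'] := tr; have tl : 0 < t < l by rewrite t0 (lt_le_trans tr').
rewrite part_mulmx; apply: eq_bigr => q _; congr (_ * _).
rewrite (kernel_sE _ _ _ xl tl) /real_kernel !indicE !mem_setE/= !in_itv/=.
by rewrite xl tl !mulr1.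
Qed.

Lemma inL2_operator_S r f :
  r <= l -> inL2 r f -> inL2 r (operator_S l Phi1 r f).
Proof.
move=> rl rf; apply/inL2P; rewrite realify_operator_S//.
have [C C0 kC] := real_kernel_bkernel.
have rAl : `]0, r[ `<=` `]0, l[ by apply: subset_itvl; rewrite bnd_simp.
have lF : vL2on mu `]0, l[ (realify r f).
  by apply: (vL2onW (mu := mu) rAl); exact/inL2P.
have Sf := opS_L2on (mu := mu) real_coef C0 (measurable_oo0 l)
  (lebesgue_measure_oo0_lty l) kC lF.
have mr : measurable (`]0, r[%classic : set T) by exact: measurable_itv.
exact: vL2onW (@subIsetr _ _ _) (vL2on_cut mr Sf).
Qed.

Lemma realify_surj r F : vL2on mu `]0, r[ F ->
  exists2 f : R -> 'cV[R[i]]_m2, inL2 r f & realify r f = F.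
Proof.
move=> rF; pose f x := cvec (F ^~ x).
have fF : realify r f = F.
  apply/funext => -[i b]; apply/funext => x; rewrite /realify part_cvec.
  case: ifPn => // xr; rewrite (rF (i, b)).2//= in_itv/=.
  exact/negP.
by exists f => //; apply/inL2P; rewrite fF.
Qed.

(** Applying the inverse [U] to S_r f returns f almost everywhere, so |f| <= K |S_r f|. *)
Lemma opS_inverse_bound r : 0 < r <= l ->
  boundedly_invertible r (operator_S l Phi1 r) ->
  exists2 K, 0 <= K & forall F, vL2on mu `]0, r[ F ->
    vip mu F F <= K * vip mu (vcut `]0, r[ (SR F)) (vcut `]0, r[ (SR F)).
Proof.
move=> /andP[r0 rl] [U [[UL2 _ [K UK]] US]]; exists (K ^+ 2).
  exact: sqr_ge0.
move=> F /realify_surj[f rf <-].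
have rSf := inL2_operator_S rl rf.
rewrite -realify_operator_S// -!L2norm_sqr// -exprMn.
have fK : L2norm r f <= K * L2norm r (operator_S l Phi1 r f).
  rewrite -(L2norm_eqL2 (UL2 _ rSf) rf (US f rf).1); exact: UK.
(* The sign of [K] is unknown, but K |S_r f| is nonnegative because it dominates |f|, so the
   inequality may be squared. *)
by rewrite lerXn2r// nnegrE ?sqrtr_ge0// (le_trans _ fK)// sqrtr_ge0.
Qed.

(** This is complex linearity: the 2x2 block of a complex number has equal diagonal and opposite
    off-diagonal entries, hence commutes with the block of i. *)
Lemma opS_rot F : vL2on mu `]0, l[ F -> SR (rot F) = rot (SR F).
Proof.
move=> lF; have [C C0 kC] := real_kernel_bkernel.
have k_itg p q u x : L2on mu `]0, l[ u ->
    itg mu (fun y => real_kernel p q (x, y) * u y).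
  have := bkernel_itg C0 (measurable_oo0 l)
    (lebesgue_measure_oo0_lty l) x (kC p q); exact.
have kopN p q u x : L2on mu `]0, l[ u ->
    kop mu (real_kernel p q) (fun y => - u y) x =
    - kop mu (real_kernel p q) u x.
  move=> lu; rewrite -mulN1r -RintegralZl//; last exact: k_itg.
  by apply: eq_Rintegral => y _; ring.
have a10 i j :
    real_coef (i, true) (j, false) = - real_coef (i, false) (j, true).
  by rewrite /real_coef /mulpart/= expr0 expr1 mul1r mulN1r opprK.
have k10 i j u x : L2on mu `]0, l[ u ->
    kop mu (real_kernel (i, true) (j, false)) u x =
    - kop mu (real_kernel (i, false) (j, true)) u x.
  move=> lu; rewrite -mulN1r -RintegralZl//; last exact: k_itg.
  apply: eq_Rintegral => y _; rewrite /real_kernel /mulpart/= expr0 expr1.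
  by ring.
apply/funext => -[i b]; apply/funext => x; rewrite /rot /opS /= !sum_partE/=.
case: b; rewrite -?sumrN; apply: eq_bigr => j _.
  rewrite (kopN _ _ _ _ (lF (j, true))) a10 (k10 _ _ _ _ (lF (j, true))).
  rewrite -[real_coef (i, true) _]/(real_coef (i, false) (j, false)).
  rewrite -[real_kernel (i, true) _]/(real_kernel (i, false) (j, false)).
  by ring.
rewrite (kopN _ _ _ _ (lF (j, true))) a10 (k10 _ _ _ _ (lF (j, false))).
rewrite -[real_coef (i, true) _]/(real_coef (i, false) (j, false)).
by rewrite -[real_kernel (i, true) _]/(real_kernel (i, false) (j, false)); ring.
Qed.

(** This expresses the reality of <S f, f>: S is symmetric and commutes with the skew map [rot], so
    the value equals its own negative. *)
Lemma form_rot F : vL2on mu `]0, l[ F ->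
  form mu real_coef real_kernel F (rot F) = 0.
Proof.
move=> lF; have [C C0 kC] := real_kernel_bkernel.
have lRF := rot_L2on lF.
have symm := formC C0 (measurable_oo0 l) (lebesgue_measure_oo0_lty l) kC
  real_coefC real_kernelC lF lRF.
have lSF := opS_L2on (mu := mu) real_coef C0 (measurable_oo0 l)
  (lebesgue_measure_oo0_lty l) kC lF.
have : form mu real_coef real_kernel (rot F) F =
    - form mu real_coef real_kernel F (rot F).
  by rewrite /form opS_rot// (vip_rot lSF lF).
by rewrite -symm => /eqP; rewrite -addr_eq0 -mulr2n mulrn_eq0 => /eqP.
Qed.

End RealOperator.

Theorem proposition4p1 (R : realType) (m1 m2 : nat)
  (hm1 : (0 < m1)%N) (hm2 : (0 < m2)%N) (l : R) (hl : 0 < l)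
  (Phi1 : R -> 'M[R[i]]_(m2, m1))
  (hPhi1 : boundedly_differentiable `[0, l] Phi1)
  (hPhi1_0 : posdefmx (1%:M - Phi1 0 *m (Phi1 0)^t*))
  (hinv : forall r : R, 0 < r <= l ->
    boundedly_invertible r (operator_S l Phi1 r)) :
  forall r : R, 0 < r <= l -> strictly_positive r (operator_S l Phi1 r).
Proof.
move=> r rl; have /andP[r0 r_le_l] := rl.
have [alpha alpha0 a_coer] := posdefmx_coercive hPhi1_0 (A0_herm Phi1).
have [C C0 kC] := real_kernel_bkernel hl hPhi1.
have inv s (sl : 0 < s <= l) := opS_inverse_bound hl hPhi1 sl (hinv s sl).
have [delta delta0 pos] := form_strictly_positive hl C0 alpha0 kC
  (real_coefC Phi1) (real_kernelC hl hPhi1) a_coer inv rl.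
exists delta => // f rf.
set F := realify r f; set G := operator_S l Phi1 r f.
have rF : vL2on lebesgue_measure `]0, r[ F by exact/inL2P.
have rG : inL2 r G by exact: inL2_operator_S.
have rGr := (inL2P r G).1 rG.
have partE b (u v : 'cV[R[i]]_m2) i :
    part b ((u - delta%:C *: v) i 0) = part b (u i 0) - delta * part b (v i 0).
  by rewrite !mxE partB part_realM.
have gE : realify r (fun x => G x - delta%:C *: f x) =
    vlin (- delta) F (realify r G).
  apply/funext => p; apply/funext => x; rewrite /vlin /F /realify.
  case: ifP => _; last by rewrite mulr0 addr0.
  by rewrite partE mulNr addrC.
have rg : inL2 r (fun x => G x - delta%:C *: f x).
  by apply/inL2P; rewrite gE; exact: vL2on_lin.
have GF H : vL2on lebesgue_measure `]0, r[ H ->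
    vip lebesgue_measure (realify r G) H =
    form lebesgue_measure (real_coef Phi1) (real_kernel l Phi1) F H.
  move=> rH; rewrite /G realify_operator_S// /form; apply: eq_bigr => p _.
  apply: eq_Rintegral => x _; rewrite vcutE; case: ifPn => // xr.
  by rewrite (rH p).2 ?mulr0// => xr'; move: xr; rewrite mem_set.
have rRF := rot_L2on rF.
(* Nonnegativity in [R[i]] first asks for a vanishing imaginary part: [form_rot] disposes of S_r,
   and skewness of [rot] of the multiple of the identity. The real part is the real estimate
   [pos]. *)
rewrite lecE; apply/andP; split.
  rewrite -[complex.Im (L2dot _ _ _)]/(part true _) Im_L2dot// gE.
  rewrite (vip_linl _ rF rGr rRF) GF// form_rot//; last first.
    by apply: vL2onW rF; apply: subset_itvl; rewrite bnd_simp.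
  have := vip_rot rF rF; rewrite vipC => /eqP.
  rewrite -addr_eq0 -mulr2n mulrn_eq0.
  by move=> /eqP ->; rewrite mulr0 addr0.
rewrite -[complex.Re (L2dot _ _ _)]/(part false _) Re_L2dot// gE.
by rewrite (vip_linl _ rF rGr rF) GF// mulNr addrC subr_ge0; exact: pos.
Qed.
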